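(* Let $v=s_2s_3$. Then the GIT quotient $T\backslash\!\backslash (X^{v}_{w_{3,7}})^{ss}_T(\mathcal{L}(7\omega_3))$ is isomorphic to $\mathbb{P}^1$, and the descent of $\mathcal{L}(7\omega_3)$ to it is $\mathcal{O}(1)$.
   Context: $G=SL(7,\mathbb{C})$, $T$ is the subgroup of diagonal matrices, $B$ (resp. $B^-$) the subgroup of upper (resp. lower) triangular matrices, $s_i=(i,i+1)\in S_7$, and $G_{3,7}$ is the Grassmannian of $3$-dimensional subspaces of $\mathbb{C}^7$. A minimal-length coset representative $w\in S_7$ (one with $w(1)<w(2)<w(3)$ and $w(4)<\dots<w(7)$) is identified with $[w(1),w(2),w(3)]$; e.g. $s_2s_3$ corresponds to $[1,3,4]$. Put $e_w=[e_{w(1)}\wedge e_{w(2)}\wedge e_{w(3)}]$; $X(w)$ is the closure of $Be_w$, $X^v$ the closure of $B^-e_v$, $X^v_w=X(w)\cap X^v$, and $w_{3,7}=[3,5,7]$. $\mathcal{L}(\omega_3)$ is the pullback of $\mathcal{O}(1)$ under the Plücker embedding with its natural $T$-linearization, and $\mathcal{L}(7\omega_3)=\mathcal{L}(\omega_3)^{\otimes7}$. The semistable locus $X^{ss}_T(\mathcal{L})$ is the set of points of $X$ at which some $T$-invariant section over $X$ of a positive power of $\mathcal{L}$ does not vanish, and the GIT quotient is $T\backslash\!\backslash X^{ss}_T(\mathcal{L})=\mathrm{Proj}\bigoplus_{m\ge0}H^0(X,\mathcal{L}^{\otimes m})^T$. The descent of $\mathcal L$ is the line bundle on the GIT quotient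 whose pullback to $X^{ss}_T(\mathcal{L})$ is $T$-equivariantly isomorphic to $\mathcal{L}$. *)

(* Defs.v *)
From HB Require Import structures.
From mathcomp Require Import all_boot all_order all_fingroup all_algebra.
From mathcomp Require Import mpoly complex.
From mathcomp Require Import boolp classical_sets functions reals.

Set Implicit Arguments.
Unset Strict Implicit.
Unset Printing Implicit Defensive.

Import Order.TTheory GRing.Theory Num.Theory.
Local Open Scope classical_set_scope.
Local Open Scope ring_scope.

(* Varieties over an algebraically closed field K are treated classically:
   a set of (closed) points with its Zariski open sets and, on every open set,
   its regular K-valued functions.  The record holds data only; the varieties
   used below are [qproj] (locally closed subsets of a projective space) and
   [Proj] (the closed points of Proj of a graded K-algebra).  Points live in a
   subset [pts] of a type; [reg U h] depends only on the values of h on U. *)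
Record variety (K : closedFieldType) := Variety {
  carrier :> Type;
  pts : set carrier;
  opn : set (set carrier);
  reg : set carrier -> set (carrier -> K) }.
Arguments pts {K} v.
Arguments opn {K} v.
Arguments reg {K} v.

(* Data of a line bundle: the fibres are subspaces of one K-vector space, and
   [sec U] is the set of regular sections over the open set U (only the values
   on U matter).  [is_line_bundle] states local triviality. *)
Record bundle (K : closedFieldType) (X : variety K) := Bundle {
  ambient : lmodType K;
  fib : X -> set ambient;
  sec : set X -> set (X -> ambient) }.
Arguments ambient {K X} b.
Arguments fib {K X} b.
Arguments sec {K X} b.

Section Varieties.
Variable K : closedFieldType.
Implicit Types X Y : variety K.

Definition is_morphism X Y (f : X -> Y) : Prop :=
  [/\ forall x, pts X x -> pts Y (f x),
      forall U, opn Y U -> opn X (pts X `&` f @^-1` U)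
    & forall U h, opn Y U -> reg Y U h -> reg X (pts X `&` f @^-1` U) (h \o f)].

Definition is_isomorphism X Y (f : X -> Y) : Prop :=
  is_morphism f /\
  exists g : Y -> X,
    [/\ is_morphism g,
        forall x, pts X x -> g (f x) = x
      & forall y, pts Y y -> f (g y) = y].

Definition is_line_bundle X (L : bundle X) : Prop :=
  forall x, pts X x ->
  exists (U : set X) (e : X -> ambient L),
    [/\ opn X U, U x,
        forall y, U y -> e y != 0 /\ fib L y = [set a *: e y | a in [set: K]]
      & forall V s, opn X V -> V `<=` U ->
          sec L V s <->
          exists h, reg X V h /\ forall y, V y -> s y = h y *: e y].

(* f^* M: the fibre at x is the fibre of M at f x, and the sections are locally
   products of a regular function with the pullback of a section of M. *)
Definition pullback X Y (f : X -> Y) (M : bundle Y) : bundle X :=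
  @Bundle K X (ambient M) (fun x => fib M (f x))
    (fun U => [set s | forall x, U x ->
       fib M (f x) (s x) /\
       exists V W h m,
         [/\ opn X V /\ opn Y W,
             V x /\ V `<=` U,
             forall y, V y -> W (f y),
             reg X V h /\ sec M W m
           & forall y, V y -> s y = h y *: m (f y)]]).

Definition is_bundle_iso X (L M : bundle X)
    (psi : X -> ambient L -> ambient M) : Prop :=
  (forall x, pts X x ->
     set_bij (fib L x) (fib M x) (psi x) /\
     (forall a l l', fib L x l -> fib L x l' ->
        psi x (a *: l + l') = a *: psi x l + psi x l')) /\
  (forall U s, opn X U -> (forall x, U x -> fib L x (s x)) ->
     sec L U s <-> sec M U (fun x => psi x (s x))).

End Varieties.

Section Projective.
Variables (K : closedFieldType) (n : nat).
Local Notation line := {vspace 'cV[K]_n}.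
Implicit Types (l : line) (X U V : set line) (d e : nat).

Definition proj_space : set line := [set l | \dim l = 1%N].

Definition pval (f : {mpoly K[n]}) (v : 'cV[K]_n) : K := f.@[fun i => v i ord0].

Definition zariski_closed (Z : set line) : Prop :=
  exists S : set {mpoly K[n]},
    (forall f, S f -> exists d, f \is d.-homog) /\
    Z = proj_space `&`
        [set l : line | forall f v, S f -> v \in l -> pval f v = 0].

Definition zariski_closure (A : set line) : set line :=
  \bigcap_(Z in [set Z | zariski_closed Z /\ A `<=` Z]) Z.

Definition qopen X : set (set line) :=
  [set U | exists2 Z, zariski_closed Z & U = X `\` Z].

(* The variety structure of a locally closed subset X of the projective space:
   regular functions are locally quotients of forms of the same degree. *)
Definition qproj X : variety K :=
  @Variety K line X (qopen X)
    (fun U => [set h | forall l, U l ->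
       exists V d f g,
         [/\ qopen X V,
             V l /\ V `<=` U,
             (f \is d.-homog) && (g \is d.-homog)
           & forall l' v, V l' -> v \in l' -> v != 0 ->
               pval g v != 0 /\ h l' = pval f v / pval g v]]).

(* The line bundle O(d) on X, i.e. the d-th tensor power of O(1).  O(-1) is the
   tautological bundle, so the fibre of O(d) at a line l is the space of
   functions on l minus 0 which are homogeneous of degree d; they are extended
   by 0 to all of K^n. *)
Definition twist X d : bundle (qproj X) :=
  @Bundle K (qproj X) ('cV[K]_n -> K^o)
    (fun l => [set s |
       (forall v, (v \notin l) || (v == 0) -> s v = 0) /\
       (forall a v, a != 0 -> s (a *: v) = a ^+ d * s v)])
    (fun U => [set s | forall l, U l ->
       [/\ forall v, (v \notin l) || (v == 0) -> s l v = 0,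
           forall a v, a != 0 -> s l (a *: v) = a ^+ d * s l v
         & exists V e f g,
             [/\ qopen X V,
                 V l /\ V `<=` U,
                 (f \is (d + e).-homog) && (g \is e.-homog)
               & forall l' v, V l' -> v \in l' -> v != 0 ->
                   pval g v != 0 /\ s l' v = pval f v / pval g v]]]).

Definition lmove (t : 'M[K]_n) l : line := (linfun (mulmx t) @: l)%VS.

(* The natural linearization of O(d): t maps a function s on a line l to the
   function s \o t^-1 on the line t l. *)
Definition smove (t : 'M[K]_n) (s : 'cV[K]_n -> K) : 'cV[K]_n -> K :=
  fun v => s (invmx t *m v).

End Projective.
Arguments proj_space {K} n.

(* Proj of a graded K-algebra \bigoplus_m R m, whose homogeneous components are
   given as subsets of a commutative ring A; iota embeds the constants.
   A homogeneous prime ideal is given by its homogeneous components. *)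
Section Proj.
Variables (K : closedFieldType) (A : comPzRingType) (iota : K -> A).
Variable R : nat -> set A.

Definition relevant_prime (p : nat -> set A) : Prop :=
  [/\ forall m, p m `<=` R m,
      forall m, p m 0 /\ (forall f g, p m f -> p m g -> p m (f - g)),
      forall k m f g, R k f -> p m g -> p (k + m)%N (f * g),
      forall k m f g, R k f -> R m g -> p (k + m)%N (f * g) -> p k f \/ p m g
    & exists m f, [/\ (0 < m)%N, R m f & ~ p m f]].

Definition proj_point : set (nat -> set A) :=
  [set p | relevant_prime p /\
     forall q, relevant_prime q -> (forall m, p m `<=` q m) -> q = p].

Definition proj_open : set (set (nat -> set A)) :=
  [set U | exists S : nat -> set A,
     (forall m, S m `<=` R m) /\
     U = proj_point `&` [set p | exists m f, S m f /\ ~ p m f]].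

(* The residue fields at the closed points are K; the value at p of the fraction
   f / g is the constant c such that f - c g belongs to p. *)
Definition Proj : variety K :=
  @Variety K (nat -> set A) proj_point proj_open
    (fun U => [set h | forall p, U p ->
       exists V d f g,
         [/\ proj_open V,
             V p /\ V `<=` U,
             R d f /\ R d g
           & forall q, V q -> ~ q d g /\ q d (f - iota (h q) * g)]]).

End Proj.

(* GIT quotients of a subvariety X of the projective space, for the line bundle
   O(d) and a group H of matrices acting linearly and preserving X. *)
Section GIT.
Variables (K : closedFieldType) (n : nat).
Variables (H : set 'M[K]_n) (X : set {vspace 'cV[K]_n}) (d : nat).
Local Notation line := {vspace 'cV[K]_n}.

(* H^0(X, O(m))^H; a section is made a unique function by letting it be 0
   off X. *)
Definition inv_sections (m : nat) : set (line -> 'cV[K]_n -> K) :=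
  [set s |
    [/\ sec (twist X m) X s,
        forall l, ~ X l -> s l = (fun=> 0)
      & forall t l, H t -> X l -> s (lmove t l) = smove t (s l)]].

Definition semistable : set line :=
  [set l | X l /\
     exists m s v, [/\ (0 < m)%N, inv_sections (m * d)%N s & s l v != 0]].

Definition git_quotient : variety K :=
  @Proj K (line -> 'cV[K]_n -> K) (fun c => fun _ _ => c)
    (fun m => inv_sections (m * d)%N).

Definition git_map : qproj semistable -> git_quotient :=
  fun l m => [set s | inv_sections (m * d)%N s /\ s l = (fun=> 0)].

(* M is the descent of O(d) to the GIT quotient: its pullback to the semistable
   locus is H-equivariantly isomorphic to O(d).  H acts trivially on the fibres
   of the pullback, since git_map is H-invariant. *)
Definition is_descent (M : bundle git_quotient) : Prop :=
  is_line_bundle M /\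
  exists psi : qproj semistable ->
      ambient (twist semistable d) -> ambient (pullback git_map M),
    is_bundle_iso psi /\
    forall t l s, H t -> semistable l -> fib (twist semistable d) l s ->
      psi (lmove t l) (smove t s) = psi l s.

End GIT.

Section Grassmannian.
Variables (K : closedFieldType) (k n : nat).

Definition increasing : pred {ffun 'I_k -> 'I_n} :=
  [pred I : {ffun 'I_k -> 'I_n} |
     [forall i : 'I_k, forall j : 'I_k, (i < j)%N ==> (I i < I j)%N]].

(* Lambda^k K^n has the basis e_I, for I increasing; coordinates are indexed by
   the enumeration of the increasing I.  [wedge M] is the wedge product of the
   columns of M. *)
Definition ext_dim : nat := #|increasing|.

Definition wedge (M : 'M[K]_(n, k)) : 'cV[K]_ext_dim :=
  \col_(a < ext_dim) \det (rowsub (enum_val a) M).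

(* The matrix of Lambda^k g. *)
Definition compound (g : 'M[K]_n) : 'M[K]_ext_dim :=
  \matrix_(a < ext_dim, b < ext_dim)
    \det (mxsub (enum_val a) (enum_val b) g).

Definition torus : set 'M[K]_n := [set g | is_diag_mx g /\ \det g = 1].
Definition borel : set 'M[K]_n := [set g | is_trig_mx g^T /\ \det g = 1].
Definition borel_opp : set 'M[K]_n := [set g | is_trig_mx g /\ \det g = 1].

Definition e_point (w : 'I_k -> 'I_n) : {vspace 'cV[K]_ext_dim} :=
  <[wedge (colsub w 1%:M)]>%VS.

(* Schubert and Richardson varieties in the Grassmannian of k-dimensional
   subspaces of K^n, in its Pluecker embedding into P(Lambda^k K^n). *)
Definition schubert (w : 'I_k -> 'I_n) : set {vspace 'cV[K]_ext_dim} :=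
  zariski_closure [set lmove (compound g) (e_point w) | g in borel].

Definition schubert_opp (v : 'I_k -> 'I_n) : set {vspace 'cV[K]_ext_dim} :=
  zariski_closure [set lmove (compound g) (e_point v) | g in borel_opp].

Definition richardson (v w : 'I_k -> 'I_n) : set {vspace 'cV[K]_ext_dim} :=
  schubert w `&` schubert_opp v.

End Grassmannian.
Arguments compound {K} k {n} g.
Arguments torus K n : clear implicits.
Arguments richardson K {k n} v w.

(* Indices are shifted by one: 'I_7 is {0, ..., 6}. *)
Definition s_ (i : nat) : 'S_7 := tperm (inord i.-1) (inord i).

(* [w(1), w(2), w(3)] *)
Definition first3 (w : 'S_7) : 'I_3 -> 'I_7 :=
  fun i => w (widen_ord (isT : 3 <= 7)%N i).

(* [3, 5, 7] *)
Definition w37 : 'I_3 -> 'I_7 := fun i => inord (nth 0%N [:: 2; 4; 6]%N i).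

(* Main.v *)
From mathcomp Require Import all_boot all_order all_fingroup all_algebra.
From mathcomp Require Import mpoly complex.
From mathcomp Require Import boolp classical_sets functions reals.
From mathcomp Require Import ring.
Require Import Defs.

(** The Richardson variety X lies in the Grassmannian of 3-planes in a space of
    dimension 7. Write p_ijk for its coordinates, with columns counted from 1.
    On X only the p_I with 134 <= I <= 357 survive. A 3-plane of X therefore
    meets the coordinate subspaces of the columns 1-3, 3-5 and 4-7, and a
    generic one is spanned by the rows of

      a1 a2 a3 0  0  0  0
      0  0  b3 b4 b5 0  0
      0  0  0  c4 c5 c6 c7 .

    Counting weights, an invariant form of degree 7m in such rows is a
    combination of the m+1 monomials x^i y^(m-i), where
      x = p134 p346 p136 p146 p257^3   and   y = p135 p346 p136 p146 p247 p257^2.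
    So the ring of invariants ought to be the polynomial ring in x and y, both
    of degree 1, and the quotient its Proj, the projective line with O(1).

    This heuristic becomes a proof without any normality of X or standard
    monomial theory, through the slice on which all entries are 1 except
    (c4, c5) = (s, t); on it, x = s and y = t.
    - [semistable_meets] is a numerical criterion: if an invariant section of
      positive degree does not vanish at l, no one-parameter subgroup of the
      torus may push l to 0. For a 3-plane V of X this bounds the dimensions of
      its intersections with coordinate subspaces by 3/7 of theirs, and
      [stable_slice] deduces, by linear algebra, that V is in the torus orbit of a
      slice point with (s, t) <> (0, 0). Invariant sections of positive degree
      are thus determined by their values on the slice, and vanish elsewhere.
    - Restricted to the lines (z, 1) and (1, z) of the slice, an invariant section
      is everywhere locally a fraction of polynomials, hence a polynomial
      ([regular_line_poly]); a one-parameter subgroup acting on the slice by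
      scalars makes it homogeneous, so it is a binary form of degree m in s and
      t ([inv_binary_form]).
    - An algebra of this kind ([binary_form_algebra]) has the projective line as
      its Proj ([proj_to_line_iso]): over an algebraically closed field a binary
      form is a product of linear ones, so a relevant prime is contained in the
      ideal of a point. Invariants of degree 0 need no separate study, for those
      that vanish on the slice are annihilated by all invariants of positive
      degree.
    - For the descent, (x, y) is homogeneous of degree 7 on each semistable line
      l, so functions on l of degree 7 correspond to functions of degree 1 on
      the line through (x, y) ([descend]). This correspondence takes the sections
      x and y to the coordinates of the plane, which are local frames of both
      bundles, and [bundle_iso_frames] applies. *)

Set Implicit Arguments.
Unset Strict Implicit.
Unset Printing Implicit Defensive.

Import Order.TTheory GRing.Theory.
Local Open Scope classical_set_scope.
Local Open Scope ring_scope.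

(** * Polynomials, forms and curves *)

Section Polynomials.
Variable K : closedFieldType.

Lemma poly_eq_off_roots (p q r : {poly K}) :
  r != 0 -> (forall z, r.[z] != 0 -> p.[z] = q.[z]) -> p = q.
Proof.
move=> r0 pq; apply/eqP; rewrite -subr_eq0; apply/negPn/negP => d0.
have /closed_nonrootP[z] : (p - q) * r != 0 by rewrite mulf_neq0.
rewrite rootM negb_or => /andP[/negP nz rz]; apply: nz.
by rewrite /root hornerD hornerN pq ?subrr.
Qed.

(** Locally a fraction everywhere on the affine line means globally a fraction
    f / g in lowest terms whose denominator has no zero, i.e. a polynomial. *)
Lemma regular_line_poly (phi : K -> K) :
  (forall z0, exists f g q : {poly K},
     [/\ g.[z0] != 0, q.[z0] != 0
       & forall z, q.[z] != 0 -> phi z * g.[z] = f.[z]]) ->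
  exists h : {poly K}, forall z, phi z = h.[z].
Proof.
move=> loc; have nz0 (p : {poly K}) z : p.[z] != 0 -> p != 0.
  by apply: contraNneq => ->; rewrite horner0.
have [f0 [g0 [q0 [g0z q0z E0]]]] := loc 0.
have g0n := nz0 _ _ g0z; have q0n := nz0 _ _ q0z.
set d := gcdp f0 g0.
have dn : d != 0 by rewrite gcdp_eq0 negb_and g0n orbT.
set f1 := f0 %/ d; set g1 := g0 %/ d.
have fE : f0 = f1 * d by rewrite divpK ?dvdp_gcdl.
have gE : g0 = g1 * d by rewrite divpK ?dvdp_gcdr.
have cop : coprimep g1 f1.
  by rewrite coprimep_sym coprimep_div_gcd // g0n orbT.
have g1n : g1 != 0 by apply: contraNneq g0n => g1E; rewrite gE g1E mul0r.
have cross z : exists f g : {poly K},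
    [/\ g.[z] != 0, phi z * g.[z] = f.[z] & f * g1 = f1 * g].
  have [f [g [q [gz qz E]]]] := loc z; exists f, g; split=> //; first exact: E.
  apply: (mulIf dn); apply: (@poly_eq_off_roots _ _ (q * q0)).
    by rewrite mulf_neq0 ?(nz0 _ _ qz).
  move=> y; rewrite hornerM mulf_eq0 negb_or => /andP[qy q0y].
  rewrite -mulrA -gE mulrAC -fE !hornerM -E // -E0 //; ring.
have g1nz z : g1.[z] != 0.
  have [f [g [gz _ E]]] := cross z; apply: contraNneq gz => g1z.
  have : g1 %| g by rewrite -(Gauss_dvdpr _ cop) -E dvdp_mull.
  by case/dvdpP => k ->; rewrite hornerM g1z mulr0.
have [c c0 g1E] : exists2 c, c != 0 & g1 = c%:P.
  have : size g1 == 1%N.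
    apply/closed_rootP => -[z /eqP]; exact/eqP/g1nz.
  by move/size_poly1P.
exists (c^-1 *: f1) => z; have [f [g [gz Ez E]]] := cross z.
apply: (mulIf gz); rewrite Ez hornerZ -mulrA -hornerM -E g1E mulrC hornerM.
by rewrite hornerC -mulrA mulfV ?mulr1.
Qed.

End Polynomials.

Section Forms.
Variables (K : closedFieldType) (n : nat).
Implicit Types (f g : {mpoly K[n]}) (v w : 'cV[K]_n) (c : 'I_n -> {poly K}).

Lemma pvalM f g v : pval (f * g) v = pval f v * pval g v.
Proof. exact: mevalM. Qed.

Lemma pvalX f k v : pval (f ^+ k) v = pval f v ^+ k.
Proof. exact: rmorphXn. Qed.

Lemma pval_homog d f a v : f \is d.-homog -> pval f (a *: v) = a ^+ d * pval f v.
Proof.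
move=> /dhomogP fd; rewrite /pval !mevalE mulr_sumr; apply: eq_big_seq => m mf.
rewrite mulrCA; congr (_ * _); under eq_bigr => i _ do rewrite mxE exprMn.
have <- := fd m mf; rewrite big_split /= prodrXr.
by rewrite mdegE.
Qed.

Lemma homog_comp k d e (f : {mpoly K[k]}) (G : k.-tuple {mpoly K[n]}) :
  f \is d.-homog -> (forall i, tnth G i \is e.-homog) ->
  f \mPo G \is (e * d).-homog.
Proof.
move=> /dhomogP fd Ge; rewrite comp_mpolyE big_seq; apply: rpred_sum => m mf.
apply: dhomogZ; have <- := fd m mf; rewrite /= mdegE big_distrr /=.
apply: (big_ind2 (fun (p : {mpoly K[n]}) j => p \is j.-homog)).
- exact: dhomog1.
- by move=> p a q b; exact: dhomogM.
- by move=> i _; exact: dhomogMn.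
Qed.

Lemma pval_comp k (f : {mpoly K[k]}) (G : k.-tuple {mpoly K[n]}) v :
  pval (f \mPo G) v = pval f (\col_i pval (tnth G i) v).
Proof.
by rewrite /pval comp_mpoly_meval; apply: meval_eq => i; rewrite mxE.
Qed.

Definition curve_point c z : 'cV[K]_n := \col_i (c i).[z].

Lemma pval_curve f c : exists F : {poly K}, forall z, F.[z] = pval f (curve_point c z).
Proof.
exists (\sum_(m <- msupp f) f@_m *: \prod_i c i ^+ m i) => z.
rewrite /pval mevalE horner_sum; apply: eq_bigr => m _.
rewrite hornerZ horner_prod; congr (_ * _); apply: eq_bigr => i _.
by rewrite horner_exp mxE.
Qed.

End Forms.

(** * Lines, closed sets and principal open sets *)

Section Lines.
Variables (K : closedFieldType) (n : nat).
Local Notation line := {vspace 'cV[K]_n}.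
Implicit Types (l : line) (X U V Z A : set line) (v w : 'cV[K]_n).
Implicit Types (f g : {mpoly K[n]}).

Lemma line_point v : v != 0 -> proj_space n <[v]>%VS.
Proof. by move=> v0; rewrite /proj_space /= dim_vline v0. Qed.

Lemma lineE l v : proj_space n l -> v \in l -> v != 0 -> l = <[v]>%VS.
Proof.
move=> l1 vl v0; apply/eqP; rewrite eq_sym eqEdim -memvE vl.
by rewrite (l1 : \dim l = 1%N) dim_vline v0.
Qed.

Lemma line_has l : proj_space n l -> exists2 v, v != 0 & l = <[v]>%VS.
Proof.
move=> l1; have l0 : l != 0%VS by rewrite -dimv_eq0 (l1 : \dim l = 1%N).
exists (vpick l); first by rewrite vpick0.
by apply: lineE => //; rewrite ?memv_pick ?vpick0.
Qed.

Definition nonvanishing f : set line := [set l : line | exists2 v : 'cV[K]_n, v \in l & pval f v != 0].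

Lemma pval0_homog d f v : f \is d.-homog -> v != 0 ->
  forall w, w \in <[v]>%VS -> pval f v = 0 -> pval f w = 0.
Proof.
move=> fd v0 w /vlineP[a ->] fv.
by rewrite (pval_homog _ _ fd) fv mulr0.
Qed.

Lemma nonvanishing_line d f v : f \is d.-homog -> v != 0 ->
  nonvanishing f <[v]>%VS <-> pval f v != 0.
Proof.
move=> fd v0; split=> [[w wv]|fv]; last by exists v; rewrite ?memv_line.
by apply: contra_neq; apply: (pval0_homog fd).
Qed.

(** The sets on which a single form does not vanish are a basis of the topology;
    the complement of U is cut out by all forms whose set lies in U. *)
Lemma qopenP X U : X `<=` proj_space n ->
  qopen X U <-> U `<=` X /\ (forall l, U l -> exists d f,
     [/\ f \is d.-homog, nonvanishing f l & X `&` nonvanishing f `<=` U]).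
Proof.
move=> Xp; split=> [[Z [S [Sd ->]] ->]|[UX loc]].
  split=> [l []//|l [Xl /not_andP[/(_ (Xp _ Xl))//|]]].
  move=> /existsNP[f] /existsNP[v] /not_implyP[Sf] /not_implyP[vl fv].
  have [d fd] := Sd _ Sf; exists d, f; split=> //; first by exists v => //; exact/eqP.
  move=> l' [Xl' [w wl' /eqP fw]]; split=> // -[_ /(_ f w Sf wl')]; exact: fw.
pose S := [set f : {mpoly K[n]} |
   (exists d, f \is d.-homog) /\ X `&` nonvanishing f `<=` U].
exists (proj_space n `&` [set l : line | forall f v, S f -> v \in l -> pval f v = 0]).
  by exists S; split=> // f [].
rewrite predeqE => l; split=> [Ul|[Xl]].
  split; first exact: UX.
  have [d [f [fd [v vl fv] fU]]] := loc _ Ul.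
  by case=> _ /(_ f v) E; move/eqP: fv; apply; apply: E => //; split=> //; exists d.
move/not_andP=> [/(_ (Xp _ Xl))//|].
move=> /existsNP[f] /existsNP[v] /not_implyP[[_ fU]] /not_implyP[vl /eqP fv].
by apply: fU; split=> //; exists v.
Qed.

Lemma qopen_nonvanishing X d f : X `<=` proj_space n -> f \is d.-homog ->
  qopen X (X `&` nonvanishing f).
Proof.
move=> Xp fd; apply/qopenP => //; split=> [l []//|l [_ fl]].
by exists d, f; split.
Qed.

Lemma qopenT X : X `<=` proj_space n -> qopen X X.
Proof.
move=> Xp; apply/qopenP => //; split=> // l Xl.
exists 0%N, 1; split; [exact: dhomog1| |by move=> ? []].
by have [v v0 ->] := line_has (Xp _ Xl); exists v; rewrite ?memv_line // /pval meval1 oner_eq0.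
Qed.

Lemma nonvanishingM f g d e : f \is d.-homog -> g \is e.-homog ->
  proj_space n `&` nonvanishing (f * g) = proj_space n `&` (nonvanishing f `&` nonvanishing g).
Proof.
move=> fd ge; rewrite predeqE => l; split=> -[l1]; have [v v0 lE] := line_has l1; subst l.
  move=> /(nonvanishing_line (dhomogM fd ge) v0); rewrite pvalM mulf_eq0 negb_or.
  by move=> /andP[fv gv]; split=> //; split; exists v; rewrite ?memv_line.
move=> [/(nonvanishing_line fd v0) fv /(nonvanishing_line ge v0) gv]; split=> //.
by apply/(nonvanishing_line (dhomogM fd ge) v0); rewrite pvalM mulf_neq0.
Qed.

Lemma qopenI X U V : X `<=` proj_space n -> qopen X U -> qopen X V -> qopen X (U `&` V).
Proof.
move=> Xp /(qopenP _ Xp)[UX Uloc] /(qopenP _ Xp)[VX Vloc].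
apply/qopenP => //; split=> [l []/UX//|l [Ul Vl]].
have [d [f [fd fl fU]]] := Uloc _ Ul; have [e [g [ge gl gV]]] := Vloc _ Vl.
have E := nonvanishingM fd ge.
exists (d + e)%N, (f * g); split; first exact: dhomogM.
  suff : (proj_space n `&` nonvanishing (f * g)) l by case.
  by rewrite E; split=> //; apply/Xp/UX.
move=> l' [Xl' fgl']; have : (proj_space n `&` nonvanishing (f * g)) l'.
  by split=> //; exact: Xp.
by rewrite E => -[_ [? ?]]; split; [apply: fU|apply: gV].
Qed.

Lemma closure_vanish A d f : f \is d.-homog -> A `<=` proj_space n ->
  (forall l v, A l -> v \in l -> pval f v = 0) ->
  forall l v, zariski_closure A l -> v \in l -> pval f v = 0.
Proof.
move=> fd Ap fA l v cl vl.
have [|_ /= ] := cl (proj_space n `&` [set l : line | forall g v, [set f] g -> v \in l -> pval g v = 0]).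
  split; first by exists [set f]; split=> // _ ->; exists d.
  by move=> l' Al'; split=> [|g w ->]; [exact: Ap|exact: fA].
by apply.
Qed.

Lemma closure_proj_space A : A `<=` proj_space n -> zariski_closure A `<=` proj_space n.
Proof.
move=> Ap l cl; apply: (cl (proj_space n) (conj _ Ap)).
by exists set0; split=> //; rewrite predeqE => l'; split=> [l1|[] //]; split=> // f v [].
Qed.

Lemma sub_closure A : A `<=` zariski_closure A.
Proof. by move=> l Al Z [_ AZ]; exact: AZ. Qed.

(** A form restricts to a polynomial on a polynomial curve, and a polynomial with
    infinitely many roots is zero: closed sets contain limits along curves. *)
Lemma closed_curve Z (c : 'I_n -> {poly K}) (q : {poly K}) z0 :
  zariski_closed Z -> q != 0 -> curve_point c z0 != 0 ->
  (forall z, q.[z] != 0 -> curve_point c z != 0 -> Z <[curve_point c z]>%VS) ->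
  Z <[curve_point c z0]>%VS.
Proof.
move=> [S [Sd ->]] q0 c0 cZ; split; first exact: line_point.
move=> f v Sf vl; have [d fd] := Sd _ Sf.
apply: (pval0_homog fd c0 vl); have [F FE] := pval_curve f c.
suff F0 : F = 0 by rewrite -FE F0 horner0.
have [i ci0] : exists i, (c i).[z0] != 0.
  by case/matrix0Pn: c0 => i [j]; rewrite !mxE; exists i.
apply: (@poly_eq_off_roots _ _ _ (q * c i)).
  by rewrite mulf_neq0 //; apply: contraNneq ci0 => ->; rewrite horner0.
move=> z; rewrite hornerM mulf_eq0 negb_or => /andP[qz ciz].
rewrite FE horner0.
have cz : curve_point c z != 0.
  by apply: contraNneq ciz => /matrixP/(_ i ord0); rewrite !mxE => ->.
by have [_ /(_ f _ Sf (memv_line _))] := cZ z qz cz.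
Qed.

End Lines.

(** * Sheaves of functions, frames of line bundles *)

Section Frames.
Variable K : closedFieldType.
Implicit Types X Y Z : variety K.

(** What a variety must satisfy for its regular functions to be a sheaf of
    rings; the record of data by itself does not guarantee it. *)
Record function_sheaf X : Prop := FunctionSheaf {
  opn_pts : forall U, opn X U -> U `<=` pts X;
  opnI : forall U V, opn X U -> opn X V -> opn X (U `&` V);
  reg_restrict : forall U V h, opn X V -> V `<=` U -> reg X U h -> reg X V h;
  reg_glue : forall U h,
    (forall x, U x -> exists V h', [/\ opn X V, V x, V `<=` U, reg X V h'
                                     & forall y, V y -> h y = h' y]) ->
    reg X U h;
  regM : forall U h k, reg X U h -> reg X U k -> reg X U (fun x => h x * k x);
  reg1 : forall U, opn X U -> reg X U (fun=> 1) }.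

Definition section_sheaf X (L : bundle X) : Prop :=
  (forall U V s, opn X V -> V `<=` U -> sec L U s -> sec L V s) /\
  (forall U s, (forall x, U x -> exists V, [/\ opn X V, V x, V `<=` U & sec L V s]) ->
     sec L U s).

Definition frame X (L : bundle X) (U : set X) (e : X -> ambient L) : Prop :=
  [/\ opn X U,
      forall y, U y -> e y != 0 /\ fib L y = [set a *: e y | a in [set: K]]
    & forall V s, opn X V -> V `<=` U ->
        sec L V s <->
        exists h, reg X V h /\ forall y, V y -> s y = h y *: e y].
Arguments frame {X} L U e.

Lemma scaler_inj_l (V : lmodType K) (v : V) a b : v != 0 -> a *: v = b *: v -> a = b.
Proof.
move=> v0 /eqP; rewrite -subr_eq0 -scalerBl scaler_eq0 (negPf v0) orbF subr_eq0.
by move=> /eqP.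
Qed.

Lemma regW X U h h' : function_sheaf X -> opn X U -> reg X U h ->
  (forall x, U x -> h' x = h x) -> reg X U h'.
Proof. by move=> SX oU rh hh'; apply: (reg_glue SX) => x Ux; exists U, h; split. Qed.

(** The composite h is only compared with g o f on the points, since a map of
    varieties has no meaningful values elsewhere. *)
Lemma morphism_comp X Y Z (f : X -> Y) (g : Y -> Z) (h : X -> Z) :
  function_sheaf X -> is_morphism f -> is_morphism g ->
  (forall x, pts X x -> h x = g (f x)) -> is_morphism h.
Proof.
move=> SX [fp fo fr] [gp go gr] hE.
have E U : pts X `&` h @^-1` U = pts X `&` f @^-1` (pts Y `&` g @^-1` U).
  rewrite predeqE => x; split=> [[Xx /= Ux]|[Xx [_ /= Ux]]]; split=> //=.
    by split; [exact: fp|rewrite -hE].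
  by rewrite hE.
split=> [x Xx|U oU|U k oU rk]; first by rewrite hE //; exact/gp/fp.
  by rewrite E; apply/fo/go.
rewrite E; apply: (regW SX); first exact/fo/go.
  exact: (fr _ _ (go _ oU) (gr _ _ oU rk)).
by move=> x [Xx _] /=; rewrite hE.
Qed.

Section Pullback.
Variables (X Y : variety K) (f : X -> Y) (M : bundle Y).
Hypotheses (SX : function_sheaf X) (SY : function_sheaf Y).
Hypotheses (SM : section_sheaf M) (fm : is_morphism f).

Lemma pullback_section_sheaf : section_sheaf (pullback f M).
Proof.
split=> [U V s oV VU sU x Vx|U s loc x Ux].
  have [fs [V1 [W [h [m [[oV1 oW] [V1x V1U] V1W [rh sm] E]]]]]] := sU x (VU x Vx).
  split=> //; exists (V1 `&` V), W, h, m.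
  have oV1V := opnI SX oV1 oV.
  split.
  - by [].
  - by split=> // y [].
  - by move=> y [/V1W].
  - by split=> //; apply: (reg_restrict SX) rh => // y [].
  - by move=> y [/E].
have [V [oV Vx VU sV]] := loc x Ux.
have [fs [V1 [W [h [m [[oV1 oW] [V1x V1V] V1W [rh sm] E]]]]]] := sV x Vx.
by split=> //; exists V1, W, h, m; split=> //; split=> // y /V1V/VU.
Qed.

(** A section of the pullback is locally a regular function times a section of M,
    itself a regular function times e; the local factors agree because e does
    not vanish, and they glue. *)
Lemma pullback_frame U e : frame M U e ->
  frame (pullback f M) (pts X `&` f @^-1` U) (e \o f).
Proof.
move=> [oU eU sU]; have [fp fo fr] := fm; split; first exact: fo.
  by move=> y [_ Uy]; exact: eU.
move=> V s oV VU; split=> [sV|[h [rh E]] x Vx]; last first.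
  have [_ Ux] := VU x Vx; split; first by rewrite /= E //; have [_ ->] := eU _ Ux; exists (h x).
  exists V, U, h, e; split=> //; [by split|by move=> y /VU[]|].
  split=> //; apply/sU => //; exists (fun=> 1); split; first exact: (reg1 SY).
  by move=> y _; rewrite scale1r.
have [h hE] : {h : X -> K & forall y, V y -> s y = h y *: e (f y)}.
  apply: (@choice _ _ (fun y a => V y -> s y = a *: e (f y))) => y.
  have [Vy|nV] := pselect (V y); last by exists 0.
  have [_ Uy] := VU y Vy; have [+ _] := sV y Vy.
  by have [_ ->] := eU _ Uy => -[a _ <-]; exists a.
exists h; split=> //; apply: (reg_glue SX) => x Vx.
have [_ [V1 [W [h1 [m [[oV1 oW] [V1x V1V] V1W [rh1 sm] E]]]]]] := sV x Vx.
have oWU := opnI SY oW oU.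
have /(sU _ _ oWU)[|k [rk kE]] : sec M (W `&` U) m.
- by apply: SM.1 sm => // y [].
- by move=> y [].
have V1WU y : V1 y -> (W `&` U) (f y).
  by move=> V1y; split; [exact: V1W|have [] := VU y (V1V y V1y)].
exists V1, (fun y => h1 y * k (f y)); split=> //.
  apply: (regM SX) => //; apply: (reg_restrict SX) (fr _ _ oWU rk) => // y V1y.
  by split; [apply: (opn_pts SX) V1y|exact: V1WU].
move=> y V1y; have [_ Uy] := VU y (V1V y V1y).
have [e0 _] := eU _ Uy; apply: (scaler_inj_l e0).
by rewrite -hE ?E ?kE -?scalerA //; [exact: V1WU|exact: V1V].
Qed.

Lemma pullback_line_bundle : is_line_bundle M -> is_line_bundle (pullback f M).
Proof.
move=> lM x Xx; have [fp _ _] := fm.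
have [U [e [oU Ux eU sU]]] := lM _ (fp _ Xx).
have [? ? ?] := pullback_frame (And3 oU eU sU).
by exists (pts X `&` f @^-1` U), (e \o f); split.
Qed.

End Pullback.

(** A fibrewise linear map carrying local frames to local frames does not change
    the coordinate of a section, so it is bijective on fibres and preserves
    regularity in both directions. *)
Lemma bundle_iso_frames X (L M : bundle X) (psi : X -> ambient L -> ambient M) :
  function_sheaf X -> section_sheaf L -> section_sheaf M ->
  (forall x a l l', psi x (a *: l + l') = a *: psi x l + psi x l') ->
  (forall x, pts X x -> exists U e e', [/\ U x, frame L U e, frame M U e'
                                         & forall y, U y -> psi y (e y) = e' y]) ->
  is_bundle_iso psi.
Proof.
move=> SX SL SM lin fr.
have psi0 x : psi x 0 = 0.
  by have := lin x 1 0 0; rewrite !scale1r addr0 => /eqP; rewrite eq_sym -subr_eq0 addrK => /eqP.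
have psiZ x a l : psi x (a *: l) = a *: psi x l.
  by have := lin x a l 0; rewrite psi0 !addr0.
split=> [x Xx|U s oU sF].
  split=> //; have [U [e [e' [Ux [_ eU _] [_ e'U _] E]]]] := fr x Xx.
  have [_ ->] := eU x Ux; have [e'0 ->] := e'U x Ux.
  split=> [_ [a _ <-]|l l' /set_mem[a _ <-] /set_mem[b _ <-]|_ [a _ <-]].
  - by exists a; rewrite // psiZ E.
  - by rewrite !psiZ E // => /(scaler_inj_l e'0) ->.
  - by exists (a *: e x); [exists a|rewrite psiZ E].
split=> sU.
  apply: SM.2 => x Ux; have [W [e [e' [Wx [oW eW fW] [_ e'W f'W] E]]]] := fr x (opn_pts SX oU Ux).
  have oV := opnI SX oU oW; exists (U `&` W); split=> //.
  have /(fW _ _ oV)[|h [rh hE]] : sec L (U `&` W) s by apply: SL.1 sU => // y [].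
    by move=> y [].
  apply/(f'W _ _ oV); first by move=> y [].
  by exists h; split=> // y [Uy Wy]; rewrite hE // psiZ E.
apply: SL.2 => x Ux; have [W [e [e' [Wx [oW eW fW] [_ e'W f'W] E]]]] := fr x (opn_pts SX oU Ux).
have oV := opnI SX oU oW; exists (U `&` W); split=> //.
have /(f'W _ _ oV)[|h [rh hE]] : sec M (U `&` W) (fun y => psi y (s y)) by apply: SM.1 sU => // y [].
  by move=> y [].
apply/(fW _ _ oV); first by move=> y [].
exists h; split=> // y [Uy Wy]; have := sF y Uy; have [_ ->] := eW y Wy => -[a _ aE].
have [e'0 _] := e'W y Wy; have := hE y (conj Uy Wy).
by rewrite -aE psiZ E // => /(scaler_inj_l e'0) ->.
Qed.

End Frames.

(** * Regular functions and twisted sections on projective varieties *)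

Arguments frame {K X} L U e.

Section Quasiprojective.
Variables (K : closedFieldType) (n : nat) (X : set {vspace 'cV[K]_n}).
Hypothesis Xp : X `<=` proj_space n.
Local Notation line := {vspace 'cV[K]_n}.
Implicit Types (l : line) (U V Z A : set line) (v w : 'cV[K]_n).
Implicit Types (f g F : {mpoly K[n]}).

Lemma qproj_function_sheaf : function_sheaf (qproj X).
Proof.
split=> /= [U|U V|U V h oV VU hU l Vl|U h loc l Ul|U h k hU kU l Ul|U oU l Ul].
- by move=> /(qopenP _ Xp)[].
- exact: qopenI.
- have [V1 [d [f [g [oV1 [V1l V1U] fg E]]]]] := hU l (VU l Vl).
  exists (V1 `&` V), d, f, g; split=> //; first exact: qopenI.
  by move=> l' v [V1l' _]; exact: E.
- have [V [h' [oV Vl VU rh' E]]] := loc l Ul.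
  have [V1 [d [f [g [oV1 [V1l V1V] fg E1]]]]] := rh' l Vl.
  exists V1, d, f, g; split=> //; first by split=> [|y /V1V/VU].
  by move=> l' v V1l' vl' v0; rewrite E; [exact: E1|exact: V1V].
- have [V1 [d1 [f1 [g1 [oV1 [V1l V1U] /andP[f1d g1d] E1]]]]] := hU l Ul.
  have [V2 [d2 [f2 [g2 [oV2 [V2l V2U] /andP[f2d g2d] E2]]]]] := kU l Ul.
  exists (V1 `&` V2), (d1 + d2)%N, (f1 * f2), (g1 * g2); split.
  + exact: qopenI.
  + by split=> // y [/V1U].
  + by rewrite !dhomogM.
  + move=> l' v [V1l' V2l'] vl' v0.
    have [g1v ->] := E1 l' v V1l' vl' v0; have [g2v ->] := E2 l' v V2l' vl' v0.
    by rewrite !pvalM mulf_neq0 // mulf_div.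
- exists U, 0%N, 1, 1; split=> //; [by split|by rewrite !dhomog1|].
  by move=> l' v _ _ _; rewrite /pval meval1 oner_eq0 divr1.
Qed.

Lemma twist_section_sheaf d : section_sheaf (twist X d).
Proof.
split=> /= [U V s oV VU sU l Vl|U s loc l Ul].
  have [s0 sh [V1 [e [f [g [oV1 [V1l V1U] fg E]]]]]] := sU l (VU l Vl).
  split=> //; exists (V1 `&` V), e, f, g; split=> //; first exact: qopenI.
  by move=> l' v [V1l' _]; exact: E.
have [V [oV Vl VU sV]] := loc l Ul.
have [s0 sh [V1 [e [f [g [oV1 [V1l V1V] fg E]]]]]] := sV l Vl.
by split=> //; exists V1, e, f, g; split=> //; split=> // y /V1V/VU.
Qed.

(** Extending F by 0 off l and at the origin is the convention which makes a
    function on l minus 0 a function on the whole space. *)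
Definition form_section F l v : K^o :=
  if (v \in l) && (v != 0) then pval F v else 0.

Lemma form_sectionE F l v : v \in l -> v != 0 -> form_section F l v = pval F v.
Proof. by rewrite /form_section => -> ->. Qed.

Lemma form_section_fib d F l : F \is d.-homog ->
  fib (twist X d) l (form_section F l).
Proof.
move=> Fd; split=> [v|a v a0]; rewrite /form_section.
  by case: (v \in l) => //= /eqP ->; rewrite eqxx.
rewrite scaler_eq0 rpredZeq (negPf a0) /=.
by case: ifP => _; rewrite ?mulr0 // (pval_homog _ _ Fd).
Qed.

Lemma form_section_sec d F U : F \is d.-homog -> qopen X U ->
  sec (twist X d) U (form_section F).
Proof.
move=> Fd oU l Ul; have [s0 sh] := form_section_fib l Fd; split=> //.
exists U, 0%N, F, 1; split=> //; [by split|by rewrite addn0 Fd dhomog1|].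
by move=> l' v Ul' vl' v0; rewrite form_sectionE // /pval meval1 oner_eq0 divr1.
Qed.

Lemma scale_funE a (s : 'cV[K]_n -> K^o) v : (a *: s) v = a * s v.
Proof. by []. Qed.

Lemma twist_fibZ d l a s : fib (twist X d) l s -> fib (twist X d) l (a *: s).
Proof.
move=> [s0 sh]; split=> [v v0|b v b0]; rewrite !scale_funE; first by rewrite s0 ?mulr0.
by rewrite sh // mulrCA.
Qed.

Lemma twist_fib_eq d l (s s' : 'cV[K]_n -> K^o) v : proj_space n l ->
  fib (twist X d) l s -> fib (twist X d) l s' -> v \in l -> v != 0 ->
  s v = s' v -> s = s'.
Proof.
move=> l1 [s0 sh] [s0' sh'] vl v0 E; apply/funext => w.
case: (boolP ((w \notin l) || (w == 0))) => [w0|]; first by rewrite s0 // s0'.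
rewrite negb_or negbK (lineE l1 vl v0) => /andP[/vlineP[a ->]].
rewrite scaler_eq0 negb_or => /andP[a0 _].
by rewrite sh // sh' // E.
Qed.

(** Where the form F of degree d does not vanish, dividing by F turns sections of
    O(d) into regular functions. *)
Lemma twist_frame d F : F \is d.-homog ->
  frame (twist X d) (X `&` nonvanishing F) (form_section F).
Proof.
move=> Fd; split; first exact: (qopen_nonvanishing Xp Fd).
  move=> l [Xl Fl]; have l1 := Xp Xl; have [v v0 lE] := line_has l1.
  have vl : v \in l by rewrite lE memv_line.
  have Fv : pval F v != 0 by apply/(nonvanishing_line Fd v0); rewrite -lE.
  split.
    by apply: contraNneq Fv => /(congr1 (fun s => s v)); rewrite form_sectionE // => ->.
  rewrite predeqE => s; split=> [sf|[a _ <-]].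
    exists (s v / pval F v) => //; apply: (twist_fib_eq l1 _ sf vl v0).
      exact: twist_fibZ (form_section_fib l Fd).
    by rewrite scale_funE form_sectionE // divfK.
  exact: twist_fibZ (form_section_fib l Fd).
move=> V s oV VF; split=> [sV|[h [rh hE]] l Vl]; last first.
  have [V1 [e [f [g [oV1 [V1l V1V] /andP[fe ge] E]]]]] := rh l Vl.
  have [f0 fh] := twist_fibZ (h l) (form_section_fib l Fd).
  rewrite hE //; split=> //.
  exists V1, e, (F * f), g; split=> //; first by rewrite dhomogM.
  move=> l' v V1l' vl' v0; have [gv hl] := E l' v V1l' vl' v0; split=> //.
  rewrite hE; last exact: V1V.
  by rewrite scale_funE form_sectionE // pvalM hl mulrC mulrA.
have [h hE] : {h : line -> K & forall l, V l -> s l = h l *: form_section F l}.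
  apply: (@choice _ _ (fun l a => V l -> s l = a *: form_section F l)) => l.
  have [Vl|nV] := pselect (V l); last by exists 0.
  have [Xl Fl] := VF l Vl; have l1 := Xp Xl; have [v v0 lE] := line_has l1.
  have vl : v \in l by rewrite lE memv_line.
  have Fv : pval F v != 0 by apply/(nonvanishing_line Fd v0); rewrite -lE.
  exists (s l v / pval F v) => _; have [s0 sh _] := sV l Vl.
  apply: (@twist_fib_eq d l _ _ v l1) => //.
    exact: twist_fibZ (form_section_fib l Fd).
  by rewrite scale_funE form_sectionE // divfK.
exists h; split=> // l Vl.
have [s0 sh [V1 [e [f [g [oV1 [V1l V1V] /andP[fe ge] E]]]]]] := sV l Vl.
exists V1, (d + e)%N, f, (F * g); split=> //; first by rewrite fe dhomogM.
move=> l' v V1l' vl' v0; have [gv sE] := E l' v V1l' vl' v0.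
have [Xl' Fl'] := VF l' (V1V _ V1l').
have Fv : pval F v != 0.
  by apply/(nonvanishing_line Fd v0); rewrite -(lineE (Xp Xl') vl' v0).
rewrite pvalM mulf_neq0 //; split=> //.
move: sE; rewrite hE; last exact: V1V.
rewrite scale_funE form_sectionE // => /(canRL (mulfK Fv)) ->.
by rewrite -mulrA -invfM [pval g v * _]mulrC.
Qed.

End Quasiprojective.

Section MapsByForms.
Variables (K : closedFieldType) (n k : nat).
Variables (X : set {vspace 'cV[K]_n}) (Y : set {vspace 'cV[K]_k}).
Hypotheses (Xp : X `<=` proj_space n) (Yp : Y `<=` proj_space k).

Definition form_map m (G : m.-tuple {mpoly K[n]}) (v : 'cV[K]_n) : 'cV[K]_m :=
  \col_i pval (tnth G i) v.

(** Substituting the forms G into a fraction f / g of forms of one degree gives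
    again such a fraction. *)
Lemma forms_morphism e (G : k.-tuple {mpoly K[n]}) (f : qproj X -> qproj Y) :
  (forall i, tnth G i \is e.-homog) ->
  (forall l v, X l -> v \in l -> v != 0 ->
     [/\ form_map G v != 0, f l = <[form_map G v]>%VS & Y (f l)]) ->
  is_morphism f.
Proof.
move=> Ge fG; split=> /=.
- move=> l Xl; have [v v0 lE] := line_has (Xp Xl).
  by have [] := fG l v Xl _ v0; rewrite // lE memv_line.
- move=> U /(qopenP _ Yp)[UY Uloc]; apply/qopenP => //; split=> [l []//|l [Xl Ul]].
  have [d [F [Fd FUl FU]]] := Uloc _ Ul.
  exists (e * d)%N, (F \mPo G); split; first exact: homog_comp.
    have [v v0 lE] := line_has (Xp Xl); have vl : v \in l by rewrite lE memv_line.
    have [Gv fl _] := fG l v Xl vl v0; exists v => //.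
    by rewrite pval_comp; apply/(nonvanishing_line Fd Gv); rewrite -fl.
  move=> l' [Xl' Fl']; split=> //; apply: FU.
  have [v v0 lE] := line_has (Xp Xl'); have vl : v \in l' by rewrite lE memv_line.
  have [Gv fl Yl'] := fG l' v Xl' vl v0; split=> //.
  rewrite fl; apply/(nonvanishing_line Fd Gv); rewrite -pval_comp.
  by apply/(nonvanishing_line (homog_comp Fd Ge) v0); rewrite -lE.
- move=> U h oU rh l [Xl Ul].
  have [V [d [F [H [oV [Vl VU] /andP[Fd Hd] E]]]]] := rh _ Ul.
  move: (oV) => /(qopenP _ Yp)[VY Vloc].
  exists (X `&` f @^-1` V), (e * d)%N, (F \mPo G), (H \mPo G); split.
  + apply/qopenP => //; split=> [l' []//|l' [Xl' Vl']].
    have [d' [F' [Fd' FUl FU]]] := Vloc _ Vl'.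
    exists (e * d')%N, (F' \mPo G); split; first exact: homog_comp.
      have [v v0 lE] := line_has (Xp Xl'); have vl : v \in l' by rewrite lE memv_line.
      have [Gv fl _] := fG l' v Xl' vl v0; exists v => //.
      by rewrite pval_comp; apply/(nonvanishing_line Fd' Gv); rewrite -fl.
    move=> l2 [Xl2 Fl2]; split=> //; apply: FU.
    have [v v0 lE] := line_has (Xp Xl2); have vl : v \in l2 by rewrite lE memv_line.
    have [Gv fl Yl2] := fG l2 v Xl2 vl v0; split=> //.
    rewrite fl; apply/(nonvanishing_line Fd' Gv); rewrite -pval_comp.
    by apply/(nonvanishing_line (homog_comp Fd' Ge) v0); rewrite -lE.
  + by split=> // y [? /VU].
  + by rewrite !homog_comp.
  + move=> l' v [Xl' Vl'] vl' v0; have [Gv fl _] := fG l' v Xl' vl' v0.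
    by rewrite !pval_comp; apply: E => //; rewrite fl memv_line.
Qed.

End MapsByForms.

(** Along a polynomial curve, a section of O(d) is locally a fraction of
    polynomials in the parameter. *)
Lemma section_curve (K : closedFieldType) n (X : set {vspace 'cV[K]_n}) d s
    (c : 'I_n -> {poly K}) z0 :
  X `<=` proj_space n -> sec (twist X d) X s ->
  curve_point c z0 != 0 -> X <[curve_point c z0]>%VS ->
  exists f g q : {poly K},
    [/\ g.[z0] != 0, q.[z0] != 0
      & forall z, q.[z] != 0 -> curve_point c z != 0 -> X <[curve_point c z]>%VS ->
          s <[curve_point c z]>%VS (curve_point c z) * g.[z] = f.[z]].
Proof.
move=> Xp sX c0 Xc; have [_ _ [V [e [f [g [oV [Vl _] _ E]]]]]] := sX _ Xc.
move: oV => /(qopenP _ Xp)[VX /(_ _ Vl)[e' [F [Fe' Fl FV]]]].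
have [F1 F1E] := pval_curve F c; have [f1 f1E] := pval_curve f c.
have [g1 g1E] := pval_curve g c; exists f1, g1, F1; split.
- by rewrite g1E; have [] := E _ (curve_point c z0) Vl (memv_line _) c0.
- by rewrite F1E; apply/(nonvanishing_line Fe' c0).
move=> z; rewrite F1E f1E g1E => Fz cz Xz.
have [|gz ->] := E _ (curve_point c z) _ (memv_line _) cz; last by rewrite divfK.
by apply: FV; split=> //; apply/(nonvanishing_line Fe' cz).
Qed.

(** * Binary forms and the projective line as a Proj *)

Section BinaryForms.
Variable K : closedFieldType.
Implicit Types (u : 'cV[K]_2) (F : {mpoly K[2]}) (h : {poly K}).

Lemma homogXU n (i : 'I_n) : ('X_i : {mpoly K[n]}) \is 1.-homog.
Proof. by rewrite dhomogX /= mdeg1. Qed.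

Definition i0 : 'I_2 := ord0.
Definition i1 : 'I_2 := ord_max.

Definition bform m h u : K := \sum_(i < m.+1) h`_i * u i0 ord0 ^+ i * u i1 ord0 ^+ (m - i).

Lemma bform_homog m h : exists2 F : {mpoly K[2]}, F \is m.-homog & forall u, pval F u = bform m h u.
Proof.
exists (\sum_(i < m.+1) h`_i *: ('X_i0 ^+ i * 'X_i1 ^+ (m - i))).
  apply: rpred_sum => i _; apply: dhomogZ.
  have := dhomogM (dhomogMn i (homogXU i0)) (dhomogMn (m - i) (homogXU i1)).
  by rewrite !mul1n subnKC // ltnSE.
move=> u; rewrite /pval raddf_sum /=; apply: eq_bigr => i _.
by rewrite mevalZ mevalM !rmorphXn /= !mevalXU mulrA.
Qed.

Lemma homog_bform m F : F \is m.-homog -> exists h, forall u, pval F u = bform m h u.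
Proof.
move=> /dhomogP Fm.
exists (\sum_(a <- msupp F) F@_a *: 'X^(a i0)) => u.
rewrite /pval mevalE /bform.
under [RHS]eq_bigr => i _ do rewrite coef_sum !big_distrl /=.
rewrite exchange_big /= big_seq [RHS]big_seq; apply: eq_bigr => a am.
have E1 : lift ord0 ord0 = i1 by exact/val_inj.
have := Fm _ am; rewrite /= mdegE big_ord_recl big_ord1 E1 -/i0 => am'.
rewrite big_ord_recl big_ord1 E1 -/i0.
have a0 : (a i0 < m.+1)%N by rewrite ltnS -am' leq_addr.
rewrite (bigD1 (Ordinal a0)) //= coefZ coefXn eqxx mulr1 big1 ?addr0.
  rewrite -mulrA -am'; congr (_ * (_ * _ ^+ _)).
  by rewrite addKn.
move=> i /negPf ia; rewrite coefZ coefXn.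
have -> : (i == a i0 :> nat) = false by apply: contraFF ia => /eqP E; exact/eqP/val_inj.
by rewrite mulr0 !mul0r.
Qed.

(** Consequently a prime which contains both variables contains all elements of
    positive degree, and is not relevant. *)
Lemma homog_split m F : F \is m.+1.-homog ->
  exists F0 F1 : {mpoly K[2]}, [/\ F0 \is m.-homog, F1 \is m.-homog &
    forall u, pval F u = u i0 ord0 * pval F0 u + u i1 ord0 * pval F1 u].
Proof.
move=> /homog_bform[h hE]; have [F1 F1m F1E] := bform_homog m h.
have [F0 F0m F0E] := bform_homog m (h`_m.+1 *: 'X^m).
exists F0, F1; split=> // u; rewrite hE F0E F1E.
have -> : bform m (h`_m.+1 *: 'X^m) u = h`_m.+1 * u i0 ord0 ^+ m.
  rewrite /bform big_ord_recr /= big1 => [|i _]; last first.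
    by rewrite coefZ coefXn (ltn_eqF (ltn_ord i)) mulr0 !mul0r.
  by rewrite add0r coefZ coefXn eqxx subnn !mulr1.
rewrite /bform big_ord_recr /= subnn mulr1 addrC mulrCA -exprS; congr (_ + _).
rewrite mulr_sumr; apply: eq_bigr => i _.
by rewrite (subSn (ltnSE (ltn_ord i))) exprS; ring.
Qed.

End BinaryForms.

(** A graded algebra whose homogeneous elements are read off, by evaluation at
    the nonzero vectors u of the plane, as binary forms. Elements all of whose
    values are zero need not be zero; it is enough that they lie in every
    relevant prime. *)
Record binary_form_algebra (K : closedFieldType) (A : comPzRingType) (iota : K -> A)
    (R : nat -> set A) (ev : 'cV[K]_2 -> A -> K) : Prop := BinaryFormAlgebra {
  bf_sub : forall m f g, R m f -> R m g -> R m (f - g);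
  bf_mul : forall k m f g, R k f -> R m g -> R (k + m)%N (f * g);
  bf_scale : forall m c f, R m f -> R m (iota c * f);
  bf_evB : forall u f g, ev u (f - g) = ev u f - ev u g;
  bf_evM : forall u f g, ev u (f * g) = ev u f * ev u g;
  bf_evC : forall u c, ev u (iota c) = c;
  bf_realize : forall m (F : {mpoly K[2]}), F \is m.-homog ->
    exists2 f, R m f & forall u, u != 0 -> ev u f = pval F u;
  bf_form : forall m f, R m f ->
    exists2 F : {mpoly K[2]}, F \is m.-homog & forall u, u != 0 -> ev u f = pval F u;
  bf_null : forall p m f, relevant_prime R p -> R m f ->
    (forall u, u != 0 -> ev u f = 0) -> p m f }.

Section ProjLine.
Variables (K : closedFieldType) (A : comPzRingType) (iota : K -> A).
Variables (R : nat -> set A) (ev : 'cV[K]_2 -> A -> K).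
Hypothesis B : binary_form_algebra iota R ev.
Local Notation line := {vspace 'cV[K]_2}.
Implicit Types (l : line) (p q : nat -> set A) (f g : A).
Local Notation P1 := (@proj_space K 2).

Definition bf_point l : nat -> set A :=
  fun m => [set f | R m f /\ forall u : 'cV[K]_2, u \in l -> u != 0 -> ev u f = 0].

Lemma ev_scale m f a u : R m f -> a != 0 -> u != 0 -> ev (a *: u) f = a ^+ m * ev u f.
Proof.
move=> /(bf_form B)[F Fm FE] a0 u0.
by rewrite !FE // ?(pval_homog _ _ Fm) // scaler_eq0 negb_or a0.
Qed.

Lemma bf_pointP l u m f : P1 l -> u \in l -> u != 0 ->
  bf_point l m f <-> R m f /\ ev u f = 0.
Proof.
move=> l1 ul u0; split=> [[Rf /(_ u ul u0)]//|[Rf fu]]; split=> // w.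
rewrite (lineE l1 ul u0) => /vlineP[a ->]; rewrite scaler_eq0 negb_or => /andP[a0 _].
by rewrite (ev_scale Rf a0 u0) fu mulr0.
Qed.

Lemma ev0 u : ev u 0 = 0.
Proof. by rewrite -(subrr 0) (bf_evB B) subrr. Qed.

Lemma bf_R0 m : R m 0.
Proof.
have [|f Rf _] := bf_realize B (m := m) (F := 0); first exact: dhomog0.
by rewrite -(subrr f); exact: (bf_sub B).
Qed.

Lemma line_coord (u : 'cV[K]_2) : u != 0 -> exists i, u i ord0 != 0.
Proof. by move=> /matrix0Pn[i [j]]; rewrite ord1; exists i. Qed.

Lemma bf_point_relevant l : P1 l -> relevant_prime R (bf_point l).
Proof.
move=> l1; have [u u0 lE] := line_has l1; have ul : u \in l by rewrite lE memv_line.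
have P m f := bf_pointP m f l1 ul u0.
split=> [m f []//|m|k m f g Rf [Rg gu]|k m f g Rf Rg|].
- split=> [|f g /P[Rf fu] /P[Rg gu]]; first by apply/P; split; [exact: bf_R0|exact: ev0].
  by apply/P; split; [exact: (bf_sub B)|rewrite (bf_evB B) fu gu subrr].
- split; first exact: (bf_mul B).
  by move=> w wl w0; rewrite (bf_evM B) gu // mulr0.
- move=> /P[_]; rewrite (bf_evM B) => /eqP; rewrite mulf_eq0 => /orP[] /eqP E.
    by left; apply/P.
  by right; apply/P.
- have [i ui] := line_coord u0; have [x Rx xE] := bf_realize B (homogXU K i).
  exists 1%N, x; split=> // /P[_]; rewrite xE // /pval mevalXU => /eqP.
  by rewrite (negPf ui).
Qed.

(** Only the values of an element matter for its membership in a relevant prime,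
    by [bf_null]. *)
Lemma prime_evZ p m c f g : relevant_prime R p -> p m f -> R m g ->
  c != 0 -> (forall u, u != 0 -> ev u f = c * ev u g) -> p m g.
Proof.
move=> pp pf Rg c0 E; have [pR psub pmul _ _] := pp.
have [|o Ro oE] := bf_realize B (m := 0%N) (F := c^-1%:MP).
  by rewrite -[_%:MP]mulr1 mul_mpolyC; apply: dhomogZ; exact: dhomog1.
rewrite -[m]add0n in pf Rg *.
have pof : p (0 + (0 + m))%N (o * f) := pmul _ _ _ _ Ro pf.
rewrite add0n in pof; have -> : g = o * f - (o * f - g) by rewrite opprB addrC subrK.
apply: (psub _).2 => //; apply: (bf_null B) => // [|u u0].
  exact/(bf_sub B)/Rg/pR.
by rewrite (bf_evB B) (bf_evM B) oE // /pval mevalC E // mulKf // subrr.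
Qed.

(** Let a and b be the linear forms dual to a basis e1, e2. If b is not in the
    prime p, an element of p factors, after dehomogenizing by b and multiplying by
    a power of b, into forms a - r b, so that one of these is in p; as b is not
    in p, the same r serves all elements of p. *)
Lemma prime_zero_aux p (e1 e2 : 'cV[K]_2) a b :
  relevant_prime R p -> R 1%N a -> R 1%N b ->
  (forall u, u != 0 -> u = ev u a *: e1 + ev u b *: e2) ->
  (forall z, z *: e1 + e2 != 0) ->
  ~ p 1%N b ->
  exists2 u, u != 0 & forall m f, p m f -> ev u f = 0.
Proof.
move=> pp Ra Rb uE z0 nb; have [pR psub pmul pprime _] := pp.
have bX k : R k.+1 (b ^+ k.+1) /\ ~ p k.+1 (b ^+ k.+1).
  elim: k => [|k [IH1 IH2]]; first by rewrite expr1.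
  rewrite exprS -[k.+2]add1n; split; first exact: (bf_mul B).
  by move=> /(pprime _ _ _ _ Rb IH1) [].
have Rl r : R 1%N (a - iota r * b) by apply: (bf_sub B) => //; exact: (bf_scale B).
have prodp rs : forall n g, R n g -> ~ p n g ->
    p (n + size rs)%N (g * \prod_(r <- rs) (a - iota r * b)) ->
    exists2 r, r \in rs & p 1%N (a - iota r * b).
  elim: rs => [|r rs IH] n g Rg ng; first by rewrite big_nil mulr1 addn0.
  rewrite big_cons mulrA /= -addn1 addnA addnAC => pg.
  have [pr|npr] := pselect (p 1%N (a - iota r * b)); first by exists r; rewrite ?mem_head.
  have [||r' r'rs pr'] := IH _ _ _ _ pg; first exact: (bf_mul B).
    by move=> /(pprime _ _ _ _ Rg (Rl r)) [].
  by exists r'; rewrite // inE r'rs orbT.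
have Rprod rs : forall n g, R n g -> R (n + size rs)%N (g * \prod_(r <- rs) (a - iota r * b)).
  elim: rs => [|r rs IH] n g Rg; first by rewrite big_nil mulr1 addn0.
  by rewrite big_cons mulrA /= -addn1 addnA addnAC; apply/IH/(bf_mul B).
have evprod u rs : u != 0 -> ev u b != 0 -> forall g,
    ev u (g * \prod_(r <- rs) (a - iota r * b))
    = ev u g * ev u b ^+ size rs * \prod_(r <- rs) (ev u a / ev u b - r).
  move=> u0 b0; elim: rs => [|r rs IH] g; first by rewrite !big_nil !mulr1.
  rewrite !big_cons mulrA IH (bf_evM B) (bf_evB B) (bf_evM B) (bf_evC B) /= exprS.
  by field.
have evb k u : ev u (b ^+ k.+1) = ev u b ^+ k.+1.
  by elim: k => [|k IH]; rewrite ?expr1 // exprS (bf_evM B) IH -exprS.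
have fE m f : p m f -> exists2 h : {poly K}, (forall z, ev (z *: e1 + e2) f = h.[z])
    & h = 0 \/ exists2 r, h.[r] = 0 & p 1%N (a - iota r * b).
  move=> pf; have Rf := pR _ _ pf; have [F Fm FE] := bf_form B Rf.
  have [h hE] := pval_curve F (fun i => e1 i ord0 *: 'X + (e2 i ord0)%:P).
  have hE' z : ev (z *: e1 + e2) f = h.[z].
    rewrite FE // hE; congr (pval _ _); apply/matrixP => i j.
    by rewrite ord1 !mxE hornerD hornerZ hornerX hornerC mulrC.
  exists h => //; have [->|h0] := eqVneq h 0; first by left.
  right; have [rs hrs] := closed_field_poly_normal h.
  set c := lead_coef h in hrs; have c0 : c != 0 by rewrite lead_coef_eq0.
  have [Rbm nbm] := bX m; have [Rbk nbk] := bX (size rs).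
  have [|r rrs pr] := prodp rs _ _ Rbm nbm; last first.
  - exists r => //; rewrite hrs hornerZ horner_prod (big_rem r) //=.
    by rewrite hornerXsubC subrr mul0r mulr0.
  - apply: (prime_evZ (f := b ^+ (size rs).+1 * f) pp _ _ c0); first 2 last.
    + move=> u u0; rewrite (_ : ev u (_ * f) = ev u b ^+ (size rs).+1 * ev u f); last first.
        by rewrite (bf_evM B) evb.
      have [b0|b0] := eqVneq (ev u b) 0.
        by rewrite (bf_evM B) evb b0 !expr0n /= !mul0r mulr0.
      rewrite evprod // evb.
      have uE' : u = ev u b *: ((ev u a / ev u b) *: e1 + e2).
        by rewrite scalerDr scalerA mulrC divfK // -uE.
      rewrite [X in _ * X = _](_ : _ = ev u b ^+ m * h.[ev u a / ev u b]); last first.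
        by rewrite [in LHS]uE' (ev_scale Rf) // hE'.
      rewrite hrs hornerZ horner_prod.
      under [in LHS]eq_bigr => r _ do rewrite hornerXsubC.
      rewrite !exprS; ring.
    + have := pmul _ _ _ _ Rbk pf.
      by rewrite addSn addnC -addSn.
    + exact: Rprod.
have [[m [f [pf [r fr pr]]]]|nr] := pselect (exists m f, p m f /\ exists2 r, ev (r *: e1 + e2) f = 0 & p 1%N (a - iota r * b)).
  exists (r *: e1 + e2) => // m' f' pf'.
  have [h hE [h0|[r' hr' pr']]] := fE _ _ pf'; first by rewrite hE h0 horner0.
  have [<-|rr'] := eqVneq r' r; first by rewrite hE.
  case: nb; apply: (prime_evZ pp (c := r' - r) _ Rb).
  - exact: (psub _).2 pr pr'.
  - by rewrite subr_eq0.
  - by move=> u u0; rewrite !(bf_evB B) !(bf_evM B) !(bf_evC B); ring.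
exists e2; first by have := z0 0; rewrite scale0r add0r.
move=> m f pf; have [h hE [h0|[r hr pr]]] := fE _ _ pf.
  by rewrite -[e2]add0r -(scale0r e1) hE h0 horner0.
by case: nr; exists m, f; split=> //; exists r; rewrite ?hE.
Qed.

End ProjLine.

Section ProjLineIso.
Variables (K : closedFieldType) (A : comPzRingType) (iota : K -> A).
Variables (R : nat -> set A) (ev : 'cV[K]_2 -> A -> K).
Hypothesis B : binary_form_algebra iota R ev.
Local Notation line := {vspace 'cV[K]_2}.
Implicit Types (l : line) (p q : nat -> set A) (f g : A).
Local Notation P1 := (@proj_space K 2).

Lemma I2P (P : 'I_2 -> Prop) : P i0 -> P i1 -> forall i, P i.
Proof.
move=> P0 P1 i; have [->|->] // : i = i0 \/ i = i1.
by case: i => [[|[|//]] Hi]; [left|right]; exact: val_inj.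
Qed.

Lemma cV2E (u : 'cV[K]_2) :
  u = u i0 ord0 *: delta_mx i0 ord0 + u i1 ord0 *: delta_mx i1 ord0.
Proof.
apply/matrixP => i j; rewrite ord1; move: i.
by apply: I2P; rewrite !mxE ?eqxx /= ?mulr1 ?mulr0 ?addr0 ?add0r.
Qed.

(** A relevant prime omits one of the two variables, by which one can
    dehomogenize. *)
Lemma prime_zero p : relevant_prime R p ->
  exists2 u, u != 0 & forall m f, p m f -> ev u f = 0.
Proof.
move=> pp; have [pR psub pmul _ [m [f [m0 Rf nf]]]] := pp.
have [x Rx xE] := bf_realize B (homogXU K i0).
have [y Ry yE] := bf_realize B (homogXU K i1).
have xE' u : u != 0 -> ev u x = u i0 ord0 by move=> u0; rewrite xE // /pval mevalXU.
have yE' u : u != 0 -> ev u y = u i1 ord0 by move=> u0; rewrite yE // /pval mevalXU.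
have [py|ny] := pselect (p 1%N y); last first.
  apply: (prime_zero_aux B pp Rx Ry _ _ ny (e1 := delta_mx i0 ord0) (e2 := delta_mx i1 ord0)).
    by move=> u u0; rewrite xE' // yE' // -cV2E.
  move=> z; apply/eqP => /matrixP/(_ i1 ord0); rewrite !mxE eqxx mulr0 add0r.
  by move/eqP; rewrite oner_eq0.
have [px|nx] := pselect (p 1%N x); last first.
  apply: (prime_zero_aux B pp Ry Rx _ _ nx (e1 := delta_mx i1 ord0) (e2 := delta_mx i0 ord0)).
    by move=> u u0; rewrite xE' // yE' // addrC -cV2E.
  move=> z; apply/eqP => /matrixP/(_ i0 ord0); rewrite !mxE eqxx mulr0 add0r.
  by move/eqP; rewrite oner_eq0.
case: nf; case: m m0 Rf => // m _ Rf.
have [F Fm FE] := bf_form B Rf; have [F0 [F1 [F0m F1m E]]] := homog_split Fm.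
have [f0 Rf0 f0E] := bf_realize B F0m; have [f1 Rf1 f1E] := bf_realize B F1m.
have pg : p m.+1 (f0 * x - f1 * (- y)).
  have p0 := (psub 1%N).1; have pNy : p 1%N (- y) by rewrite -sub0r; exact: (psub _).2.
  by rewrite -addn1; apply: (psub _).2; exact: pmul.
apply: (prime_evZ B pp pg Rf (oner_neq0 K)) => u u0.
have evN : ev u (- y) = - ev u y by rewrite -[- y]sub0r (bf_evB B) (ev0 B) sub0r.
rewrite (bf_evB B) !(bf_evM B) evN FE // E f0E // f1E // xE' // yE' //.
ring.
Qed.

(** The linear form vanishing on l separates it from all other lines. *)
Lemma bf_point_inj l l' : P1 l -> P1 l' ->
  (forall m, bf_point R ev l m `<=` bf_point R ev l' m) -> l = l'.
Proof.
move=> l1 l1' sub; have [u u0 lE] := line_has l1; have [u' u0' lE'] := line_has l1'.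
pose F : {mpoly K[2]} := u i1 ord0 *: 'X_i0 - u i0 ord0 *: 'X_i1.
have F1 : F \is 1.-homog by apply: rpredB; apply: dhomogZ; exact: homogXU.
have FE w : pval F w = u i1 ord0 * w i0 ord0 - u i0 ord0 * w i1 ord0.
  by rewrite /pval mevalB !mevalZ !mevalXU.
have [f Rf fE] := bf_realize B F1.
have [] : bf_point R ev l' 1%N f.
  apply: sub; apply/(bf_pointP B _ _ l1 _ u0); first by rewrite lE memv_line.
  by split=> //; rewrite fE // FE mulrC subrr.
move=> _ /(_ u'); rewrite lE' memv_line fE // FE => /(_ isT u0')/eqP.
rewrite subr_eq0 => /eqP E.
have [i ui] := line_coord u0.
have u'E : u' = (u' i ord0 / u i ord0) *: u.
  apply/matrixP => j k; rewrite ord1 mxE; apply: (mulIf ui); rewrite mulrAC divfK //.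
  move: i j {ui}; apply: I2P; apply: I2P => //; first by rewrite mulrC -E mulrC.
  by rewrite mulrC E mulrC.
apply: (lineE l1); last exact: u0'.
by rewrite lE u'E rpredZ // memv_line.
Qed.

(** Every relevant prime has a zero, so it lies below the ideal of a point; since
    these ideals are pairwise incomparable, they are the maximal ones. *)
Lemma proj_pointP p : proj_point R p <-> exists2 l, P1 l & p = bf_point R ev l.
Proof.
have below q : relevant_prime R q -> exists2 l, P1 l & forall m, q m `<=` bf_point R ev l m.
  move=> qq; have [u u0 qu] := prime_zero qq; exists <[u]>%VS; first exact: line_point.
  move=> m f qf; have [qR _ _ _ _] := qq.
  apply/(bf_pointP B _ _ (line_point u0) _ u0); first exact: memv_line.
  by split; [exact: qR|exact: qu qf].
split=> [[pp pmax]|[l l1 ->]].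
  by have [l l1 pl] := below _ pp; exists l => //; rewrite (pmax _ (bf_point_relevant B l1)).
split; first exact: (bf_point_relevant B l1).
move=> q qq lq; have [l' l1' ql'] := below _ qq.
have ll' : l = l' by apply: bf_point_inj => // m f /lq/ql'.
by apply/funext => m; apply/seteqP; split=> [f /ql'|]; rewrite ?ll' -?ll' //; exact: lq.
Qed.

Lemma Proj_function_sheaf : function_sheaf (Proj iota R).
Proof.
have mulN p k m f g : proj_point R p -> R k f -> R m g -> ~ p k f -> ~ p m g ->
    ~ p (k + m)%N (f * g).
  by move=> [[_ _ _ pr _] _] Rf Rg nf ng /(pr _ _ _ _ Rf Rg) [].
have oI U V : proj_open R U -> proj_open R V -> proj_open R (U `&` V).
  move=> [S [SR ->]] [S' [SR' ->]].
  exists (fun n => [set h | exists k m f g, [/\ n = (k + m)%N, h = f * g, S k f & S' m g]]).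
  split=> [n _ [k [m [f [g [-> -> Sf Sg]]]]]|].
    by apply: (bf_mul B); [exact: SR|exact: SR'].
  rewrite predeqE => p; split.
    move=> [[pp [k [f [Sf nf]]]] [_ [m [g [Sg ng]]]]]; split=> //.
    exists (k + m)%N, (f * g); split; first by exists k, m, f, g.
    by apply: mulN => //; [exact: SR|exact: SR'].
  move=> [pp [n [_ [[k [m [f [g [-> -> Sf Sg]]]]] nfg]]]]; have [[pR _ pm _ _] _] := pp.
  split; split=> //; [exists k, f|exists m, g]; split=> // pf; apply: nfg.
    by rewrite addnC mulrC; apply: pm pf; exact: SR'.
  by apply: pm pf; exact: SR.
split=> /= [U|U V|U V h oV VU hU p Vp|U h loc p Up|U h k hU kU p Up|U oU p Up].
- by move=> [S [_ ->]] p [].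
- exact: oI.
- have [V1 [d [f [g [oV1 [V1p V1U] fg E]]]]] := hU p (VU p Vp).
  exists (V1 `&` V), d, f, g; split=> //; first exact: oI.
  by move=> q [V1q _]; exact: E.
- have [V [h' [oV Vp VU rh' E]]] := loc p Up.
  have [V1 [d [f [g [oV1 [V1p V1V] fg E1]]]]] := rh' p Vp.
  exists V1, d, f, g; split=> //; first by split=> [|y /V1V/VU].
  by move=> q V1q; rewrite E; [exact: E1|exact: V1V].
- have [V1 [d1 [f1 [g1 [oV1 [V1p V1U] [Rf1 Rg1] E1]]]]] := hU p Up.
  have [V2 [d2 [f2 [g2 [oV2 [V2p V2U] [Rf2 Rg2] E2]]]]] := kU p Up.
  have oV := oI _ _ oV1 oV2.
  exists (V1 `&` V2), (d1 + d2)%N, (f1 * f2), (g1 * g2); split=> //.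
  + by split=> // y [/V1U].
  + by split; exact: (bf_mul B).
  + move=> q [V1q V2q]; have [ng1 q1] := E1 q V1q; have [ng2 q2] := E2 q V2q.
    have qq : proj_point R q by move: oV1 V1q => [S [_ ->]] [].
    split; first exact: mulN.
    have /proj_pointP[l l1 qE] := qq; have [u u0 lE] := line_has l1.
    have ul : u \in l by rewrite lE memv_line.
    move: q1 q2; rewrite qE => /(bf_pointP B _ _ l1 ul u0)[_ +] /(bf_pointP B _ _ l1 ul u0)[_ +].
    rewrite !(bf_evB B) !(bf_evM B) !(bf_evC B) => /eqP; rewrite subr_eq0 => /eqP e1 /eqP.
    rewrite subr_eq0 => /eqP e2.
    apply/(bf_pointP B _ _ l1 ul u0); split.
      by apply: (bf_sub B); [exact: (bf_mul B)|apply/(bf_scale B)/(bf_mul B)].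
    by rewrite (bf_evB B) !(bf_evM B) (bf_evC B) e1 e2; ring.
- have [o Ro oE] := bf_realize B (m := 0%N) (F := 1) (dhomog1 _ _).
  exists U, 0%N, o, o; split=> //; first by split.
  move=> q Uq; have /proj_pointP[l l1 qE] : proj_point R q by move: oU Uq => [S [_ ->]] [].
  have [u u0 lE] := line_has l1; have ul : u \in l by rewrite lE memv_line.
  rewrite qE; split.
    by move=> /(bf_pointP B _ _ l1 ul u0)[_ /eqP]; rewrite oE // /pval meval1 oner_eq0.
  apply/(bf_pointP B _ _ l1 ul u0); split; first by apply: (bf_sub B) => //; exact: (bf_scale B).
  by rewrite (bf_evB B) (bf_evM B) (bf_evC B) mul1r subrr.
Qed.

Definition proj_to_line p : line := xget 0%VS [set l | P1 l /\ p = bf_point R ev l].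

Lemma proj_to_lineK l : P1 l -> proj_to_line (bf_point R ev l) = l.
Proof.
move=> l1; rewrite /proj_to_line; case: xgetP => [l' _ [l1' E]|/(_ l)]; last by case.
by apply: bf_point_inj => // m f; rewrite E.
Qed.

Lemma proj_to_lineP p : proj_point R p ->
  P1 (proj_to_line p) /\ p = bf_point R ev (proj_to_line p).
Proof. by move=> /proj_pointP[l l1 ->]; rewrite proj_to_lineK. Qed.

Lemma nonvanishing_bf_point l m f F : P1 l -> R m f -> F \is m.-homog ->
  (forall u, u != 0 -> ev u f = pval F u) ->
  nonvanishing F l <-> ~ bf_point R ev l m f.
Proof.
move=> l1 Rf Fm fE; have [u u0 lE] := line_has l1.
have ul : u \in l by rewrite lE memv_line.
rewrite {1}lE (nonvanishing_line Fm u0) (bf_pointP B _ _ l1 ul u0) fE //.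
by split=> [/eqP F0 [_]//|nF]; apply/eqP => F0; apply: nF.
Qed.

Lemma proj_to_line_open (U : set line) : qopen P1 U ->
  proj_open R (proj_point R `&` proj_to_line @^-1` U).
Proof.
move=> /(qopenP _ (@subset_refl _ _))[UP Uloc].
exists (fun m => [set f | R m f /\ forall l, P1 l -> ~ bf_point R ev l m f -> U l]).
split=> [m f []//|]; rewrite predeqE => p; split=> -[pp].
  have [l1 pE] := proj_to_lineP pp => /= Ul; split=> //.
  have [d [F [Fd Fl FU]]] := Uloc _ Ul; have [f Rf fE] := bf_realize B Fd.
  exists d, f; split; last by rewrite pE; apply/(nonvanishing_bf_point l1 Rf Fd fE).
  split=> // l' l1' nl'; apply: FU; split=> //.
  exact/(nonvanishing_bf_point l1' Rf Fd fE).
move=> [m [f [[Rf fU] npf]]]; split=> //=; have [l1 pE] := proj_to_lineP pp.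
by apply: fU => //; rewrite -pE.
Qed.

Lemma proj_to_line_morphism : is_morphism (proj_to_line : Proj iota R -> qproj P1).
Proof.
split=> [p /proj_to_lineP[]//|U|U h oU rh p [pp Up]]; first exact: proj_to_line_open.
have [V [d [F [G [oV [Vl VU] /andP[Fd Gd] E]]]]] := rh _ Up.
have [f Rf fE] := bf_realize B Fd; have [g Rg gE] := bf_realize B Gd.
exists (proj_point R `&` proj_to_line @^-1` V), d, f, g; split=> //.
- exact: proj_to_line_open.
- by split=> // q [qq /VU].
- move=> q [qq Vq]; have [l1 qE] := proj_to_lineP qq; have [u u0 lE] := line_has l1.
  have ul : u \in proj_to_line q by rewrite lE memv_line.
  have [Gu hE] := E _ u Vq ul u0.
  rewrite [X in ~ X _ _](qE) [X in _ /\ X _ _](qE); split.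
    by move=> /(bf_pointP B _ _ l1 ul u0)[_ /eqP]; rewrite gE // (negPf Gu).
  apply/(bf_pointP B _ _ l1 ul u0).
  split; first by apply: (bf_sub B) => //; exact: (bf_scale B).
  by rewrite (bf_evB B) (bf_evM B) (bf_evC B) fE // gE //= hE divfK // subrr.
Qed.

Lemma bf_point_morphism : is_morphism (bf_point R ev : qproj P1 -> Proj iota R).
Proof.
have bo U : proj_open R U -> qopen P1 (P1 `&` bf_point R ev @^-1` U).
  move=> [S [SR ->]]; apply/qopenP => //; split=> [l []//|l [l1 [_ [m [f [Sf nf]]]]]].
  have Rf := SR _ _ Sf; have [F Fm fE] := bf_form B Rf.
  exists m, F; split=> //; first exact/(nonvanishing_bf_point l1 Rf Fm fE).
  move=> l' [l1' Fl']; split=> //; split; first by apply/proj_pointP; exists l'.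
  by exists m, f; split=> //; apply/(nonvanishing_bf_point l1' Rf Fm fE).
split=> [l l1|U|U h oU rh l [l1 Ul]]; [by apply/proj_pointP; exists l|exact: bo|].
have [V [d [f [g [oV [Vl VU] [Rf Rg] E]]]]] := rh _ Ul.
have [F Fd fE] := bf_form B Rf; have [G Gd gE] := bf_form B Rg.
exists (P1 `&` bf_point R ev @^-1` V), d, F, G; split.
- exact: bo.
- by split=> // l' [? /VU].
- by rewrite Fd.
- move=> l' v [l1' Vl'] vl' v0; have [ng /(bf_pointP B _ _ l1' vl' v0)[_ +]] := E _ Vl'.
  have Gv : pval G v != 0.
    by apply/eqP => G0; apply: ng; apply/(bf_pointP B _ _ l1' vl' v0); rewrite gE.
  rewrite (bf_evB B) (bf_evM B) (bf_evC B) fE // gE // => /eqP; rewrite subr_eq0 => /eqP ->.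
  by rewrite mulfK.
Qed.

Theorem proj_to_line_iso :
  is_isomorphism (proj_to_line : Proj iota R -> qproj P1).
Proof.
split; first exact: proj_to_line_morphism.
exists (bf_point R ev); split; first exact: bf_point_morphism.
- by move=> p /proj_to_lineP[].
- by move=> l /proj_to_lineK.
Qed.

End ProjLineIso.

(** * Plucker coordinates *)

Section Plucker.
Variables (K : closedFieldType) (k n : nat).
Implicit Types (I J w : 'I_k -> 'I_n) (M : 'M[K]_(n, k)) (a b : 'I_(ext_dim k n)).
Implicit Types (v : 'cV[K]_(ext_dim k n)) (t : 'M[K]_n).

Definition strictly_increasing I : Prop := forall i j : 'I_k, (i < j)%N -> (I i < I j)%N.

Lemma enum_val_increasing a : strictly_increasing (enum_val a).
Proof.
have : enum_val a \in @increasing k n by exact: enum_valP.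
by rewrite inE => /forallP inc i j ij; have /forallP/(_ j)/implyP := inc i; apply.
Qed.

Lemma strictly_increasing_inj I : strictly_increasing I -> injective I.
Proof.
move=> inc i j E; apply/val_inj/eqP; case: ltngtP => // /inc; by rewrite E ltnn.
Qed.

Lemma sorted_codom I : strictly_increasing I -> sorted ltn [seq val (I i) | i <- enum 'I_k].
Proof.
move=> inc; rewrite (map_comp val I) -map_comp.
have : sorted ltn (map val (enum 'I_k)) by rewrite val_enum_ord iota_ltn_sorted.
rewrite !sorted_map; apply: sub_sorted => i j; exact: inc.
Qed.

Lemma increasing_eq I J : strictly_increasing I -> strictly_increasing J ->
  (forall i, exists j, I i = J j) -> I =1 J.
Proof.
move=> incI incJ IJ.
have uI : uniq [seq val (I i) | i <- enum 'I_k].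
  rewrite map_inj_uniq ?enum_uniq // => i j /val_inj; exact: strictly_increasing_inj.
have E : [seq val (I i) | i <- enum 'I_k] = [seq val (J i) | i <- enum 'I_k].
  apply: (irr_sorted_eq ltn_trans ltnn); [exact: sorted_codom|exact: sorted_codom|].
  have [||_] := uniq_min_size uI (s2 := [seq val (J i) | i <- enum 'I_k]).
  - by move=> _ /mapP[i _ ->]; have [j ->] := IJ i; apply: map_f; rewrite mem_enum.
  - by rewrite !size_map.
  - by [].
move=> i; apply/val_inj.
have nthE (L : 'I_k -> 'I_n) : nth 0%N [seq val (L j) | j <- enum 'I_k] i = L i.
  by rewrite (nth_map i) ?size_enum_ord // nth_ord_enum.
by rewrite /= -nthE E nthE.
Qed.

Lemma exists_index I : strictly_increasing I -> exists a, enum_val a =1 I.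
Proof.
move=> inc; have Iin : finfun I \in @increasing k n.
  by rewrite inE; apply/forallP => i; apply/forallP => j; apply/implyP => /inc; rewrite !ffunE.
by exists (enum_rank_in Iin (finfun I)) => i; rewrite enum_rankK_in // ffunE.
Qed.

Lemma injective_sort I : injective I ->
  exists (s : 'S_k) J, strictly_increasing J /\ forall i, I i = J (s i).
Proof.
move=> injI; pose A := [set I i | i in 'I_k]%SET.
have cA : k = #|A| by rewrite card_imset // card_ord.
have AI i : I i \in A by apply: imset_f.
pose J i := enum_val (cast_ord cA i).
pose f i := cast_ord (esym cA) (enum_rank_in (AI i) (I i)).
have fE i : I i = J (f i) by rewrite /J /f cast_ordKV enum_rankK_in.
have injf : injective f by move=> i j E; apply: injI; rewrite fE E -fE.
exists (perm injf), J; split=> [i j ij|i]; last by rewrite permE.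
have so : sorted (relpre val ltn) (enum A).
  rewrite {1}/enum_mem -enumT; apply: sorted_filter => [x y z|]; first exact: ltn_trans.
  by rewrite -sorted_map val_enum_ord iota_ltn_sorted.
rewrite /J (enum_val_nth (I i)) [X in (_ < val X)%N](enum_val_nth (I i)).
apply: (sorted_ltn_nth _ _ so) => //; first by move=> x y z; exact: ltn_trans.
- rewrite inE -cardE; exact: ltn_ord.
- rewrite inE -cardE; exact: ltn_ord.
Qed.

Lemma det_noninj I M : ~ injective I -> \det (rowsub I M) = 0.
Proof.
move=> ninj; have [i [j [ij E]]] : exists i j, i != j /\ I i = I j.
  apply: contrapT => nx; apply: ninj => i j E; apply/eqP; apply: contrapT => /negP ij.
  by apply: nx; exists i, j.
by apply: (determinant_alternate ij) => c; rewrite !mxE E.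
Qed.

Lemma det_sub1 a b : \det (mxsub (enum_val a) (enum_val b) (1%:M : 'M[K]_n)) = (a == b)%:R.
Proof.
have [->|ab] := eqVneq a b.
  rewrite (_ : mxsub _ _ _ = 1%:M) ?det1 //; apply/matrixP => i j; rewrite !mxE.
  by rewrite (inj_eq (strictly_increasing_inj (@enum_val_increasing b))).
have [i ni] : exists i, forall j, enum_val a i != enum_val b j.
  apply: contrapT => nx; move/eqP: ab; apply; apply/enum_val_inj/ffunP.
  apply: increasing_eq => [||i]; try exact: enum_val_increasing.
  apply: contrapT => nj; apply: nx; exists i => j; apply/eqP => E.
  by apply: nj; exists j.
rewrite (expand_det_row _ i) big1 // => j _.
by rewrite !mxE (negPf (ni j)) mul0r.
Qed.

(** The coordinate with index set I; for an I that is not increasing, it is the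
    alternating extension, so that the coordinates of a wedge product are
    minors for every I. *)
Definition plform I : {mpoly K[ext_dim k n]} :=
  \sum_(b < ext_dim k n) \det (mxsub I (enum_val b) (1%:M : 'M[K]_n)) *: 'X_b.
Definition pl I v : K := pval (plform I) v.

Lemma plform_homog I : plform I \is 1.-homog.
Proof. by apply: rpred_sum => b _; apply: dhomogZ; exact: homogXU. Qed.

Lemma plE I v : pl I v = \sum_(b < ext_dim k n) \det (mxsub I (enum_val b) (1%:M : 'M[K]_n)) * v b ord0.
Proof.
rewrite /pl /pval raddf_sum /=; apply: eq_bigr => b _.
by rewrite mevalZ mevalXU.
Qed.

Lemma pl_enum_val a v : pl (enum_val a) v = v a ord0.
Proof.
rewrite plE (bigD1 a) //= det_sub1 eqxx mul1r big1 ?addr0 // => b ba.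
by rewrite det_sub1 eq_sym (negPf ba) mul0r.
Qed.

(** Sorting I changes both sides by the sign of the sorting permutation, and both
    vanish if I is not injective. *)
Lemma pl_wedge I M : pl I (wedge M) = \det (rowsub I M).
Proof.
have [injI|ninj] := pselect (injective I); last first.
  rewrite det_noninj // plE big1 // => b _.
  rewrite (_ : mxsub _ _ _ = rowsub I (colsub (enum_val b) 1%:M)).
    by rewrite det_noninj ?mul0r.
  by apply/matrixP => i j; rewrite !mxE.
have [s [J [incJ IJ]]] := injective_sort injI; have [a aJ] := exists_index incJ.
have IE p (B : 'M[K]_(n, p)) : rowsub I B = row_perm s (rowsub (enum_val a) B).
  by apply/matrixP => i j; rewrite !mxE IJ aJ.
have dE (B : 'M[K]_k) : \det (row_perm s B) = (-1) ^+ s * \det B.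
  by rewrite row_permE det_mulmx det_perm.
rewrite IE dE plE.
under eq_bigr => b _.
  rewrite (_ : mxsub I _ _ = row_perm s (mxsub (enum_val a) (enum_val b) 1%:M)); last first.
    by apply/matrixP => i j; rewrite !mxE IJ aJ.
  rewrite dE -mulrA; over.
rewrite -mulr_sumr -plE pl_enum_val; congr (_ * _).
by rewrite mxE.
Qed.

Definition upd I (b : 'I_k) (j : 'I_n) : 'I_k -> 'I_n := fun c => if c == b then j else I c.

(** By Cramer's rule, the minors obtained from I by one replacement are the
    entries of the product of M with the adjugate of its submatrix of rows I. *)
Lemma plucker_minors I J M :
  \det (rowsub J M) * \det (rowsub I M) ^+ k =
  \det (\matrix_(a, b) \det (rowsub (upd I b (J a)) M)) * \det (rowsub I M).
Proof.
rewrite (_ : \matrix_(_, _) _ = rowsub J M *m \adj (rowsub I M)); last first.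
  apply/matrixP => a b; rewrite !mxE (expand_det_row _ b); apply: eq_bigr => c _.
  rewrite !mxE /upd eqxx; congr (_ * _); rewrite /cofactor; congr (_ * \det _).
  apply/matrixP => i j; rewrite !mxE.
  by rewrite eq_sym (negPf (neq_lift _ _)).
by rewrite -det_mulmx -mulmxA mul_adj_mx mul_mx_scalar detZ mulrC.
Qed.

Definition plucker_form I J : {mpoly K[ext_dim k n]} :=
  plform J * plform I ^+ k - \det (\matrix_(a, b) plform (upd I b (J a))) * plform I.

Lemma plucker_form_homog I J : plucker_form I J \is (1 + k).-homog.
Proof.
apply: rpredB.
  apply: dhomogM; first exact: plform_homog.
  by have := dhomogMn k (plform_homog I); rewrite mul1n.
rewrite addnC; apply: dhomogM (plform_homog _); apply: rpred_sum => s _.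
rewrite rpredMsign; suff : \prod_(i < k) (\matrix_(a, b) plform (upd I b (J a))) i (s i)
    \is (\sum_(i < k) 1)%N.-homog by rewrite sum1_card card_ord.
apply: (big_ind2 (fun (p : {mpoly K[ext_dim k n]}) j => p \is j.-homog)).
- exact: dhomog1.
- by move=> p a q b; exact: dhomogM.
- by move=> i _; rewrite mxE; exact: plform_homog.
Qed.

Lemma pval_plucker_form I J v : pval (plucker_form I J) v =
  pl J v * pl I v ^+ k - \det (\matrix_(a, b) pl (upd I b (J a)) v) * pl I v.
Proof.
rewrite /pval mevalB !mevalM rmorphXn /= -det_map_mx; congr (_ - \det _ * _).
by apply/matrixP => a b; rewrite !mxE.
Qed.

(** If the coordinate with index set I is not zero, a matrix with wedge product
    proportional to v can be read off from the coordinates of v one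
    replacement away from I: up to the scalar, it is the one whose rows I form
    the identity. *)
Lemma plucker_decomposable v : v != 0 ->
  (forall I J, pval (plucker_form I J) v = 0) ->
  exists M c, c != 0 /\ wedge M = c *: v.
Proof.
move=> /matrix0Pn[a [j va]] rel; rewrite ord1 in va.
pose I : 'I_k -> 'I_n := enum_val a; have Iv : pl I v != 0 by rewrite pl_enum_val.
exists (\matrix_(i, b) (pl (upd I b i) v / pl I v)), (pl I v)^-1.
rewrite invr_eq0; split=> //; apply/matrixP => b j'; rewrite ord1 !mxE.
pose J : 'I_k -> 'I_n := enum_val b.
have /eqP := rel I J; rewrite pval_plucker_form subr_eq0 => /eqP E.
rewrite (_ : rowsub _ _ = (pl I v)^-1 *: \matrix_(a, b) pl (upd I b (J a)) v); last first.
  by apply/matrixP => i c; rewrite !mxE mulrC.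
rewrite detZ; apply: (mulIf Iv); rewrite -mulrA -E mulrCA exprVn.
by rewrite mulVf ?expf_neq0 // mulr1 mulrAC mulVf // mul1r; exact: pl_enum_val.
Qed.

(** The relations are polynomial, so limits of decomposable vectors are
    decomposable. *)
Lemma closure_decomposable (S : set {vspace 'cV[K]_(ext_dim k n)}) l :
  (forall l, S l -> exists2 M, wedge M != 0 & l = <[wedge M]>%VS) ->
  zariski_closure S l -> exists2 M, wedge M != 0 & l = <[wedge M]>%VS.
Proof.
move=> Sw cl.
have Sp : S `<=` proj_space _ by move=> l' /Sw[M M0 ->]; exact: line_point.
have [v v0 lE] := line_has (closure_proj_space Sp cl).
have [|M [c [c0 Mv]]] := plucker_decomposable v0; last first.
  have M0 : wedge M != 0 by rewrite Mv scaler_eq0 negb_or c0.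
  exists M => //; apply: (lineE (closure_proj_space Sp cl)) => //.
  by rewrite Mv lE rpredZ // memv_line.
move=> I J; apply: (closure_vanish (plucker_form_homog I J) Sp _ cl); last first.
  by rewrite lE memv_line.
move=> l' w /Sw[M M0 ->]; move: w; suff E : pval (plucker_form I J) (wedge M) = 0.
  by move=> w ww; apply: pval0_homog ww E => //; exact: plucker_form_homog.
rewrite pval_plucker_form !pl_wedge plucker_minors; apply/eqP; rewrite subr_eq0; apply/eqP.
congr (\det _ * _); by apply/matrixP => a b; rewrite !mxE pl_wedge.
Qed.

(** * Orbits *)

Lemma lmove_line m (g : 'M[K]_m) (u : 'cV[K]_m) : lmove g <[u]>%VS = <[g *m u]>%VS.
Proof. by rewrite /lmove limg_line lfunE. Qed.

Lemma compound_wedge g w : strictly_increasing w ->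
  compound k g *m wedge (colsub w 1%:M) = wedge (colsub w g) :> 'cV[K]_(ext_dim k n).
Proof.
move=> inc; have [c cw] := exists_index inc.
apply/matrixP => a j; rewrite ord1 !mxE (bigD1 c) //= !mxE.
have wE (a' : 'I_(ext_dim k n)) (B : 'M[K]_n) :
    rowsub (enum_val a') (colsub w B) = mxsub (enum_val a') (enum_val c) B.
  by apply/matrixP => i i'; rewrite !mxE cw.
rewrite wE det_sub1 eqxx mulr1 wE big1 ?addr0 // => b bc.
by rewrite !mxE wE det_sub1 (negPf bc) mulr0.
Qed.

Lemma orbit_point g w : strictly_increasing w ->
  lmove (compound k g) (e_point K w) = <[wedge (colsub w g)]>%VS.
Proof. by move=> inc; rewrite lmove_line compound_wedge. Qed.

Lemma diag_compound d v I :
  pl I (compound k (diag_mx d) *m v) = (\prod_i d ord0 (I i)) * pl I v.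
Proof.
have dE (J J' : 'I_k -> 'I_n) :
    \det (mxsub J J' (diag_mx d)) = (\prod_i d ord0 (J i)) * \det (mxsub J J' (1%:M : 'M[K]_n)).
  rewrite -[X in X * _](_ : \det (diag_mx (\row_i d ord0 (J i))) = _); last first.
    by rewrite det_diag; apply: eq_bigr => i _; rewrite mxE.
  rewrite -det_mulmx mul_diag_mx; congr (\det _).
  by apply/matrixP => i j; rewrite !mxE mulr_natr.
have dE' (J J' : 'I_k -> 'I_n) :
    \det (mxsub J J' (diag_mx d)) = \det (mxsub J J' (1%:M : 'M[K]_n)) * (\prod_i d ord0 (J' i)).
  rewrite -[X in _ * X](_ : \det (diag_mx (\row_i d ord0 (J' i))) = _); last first.
    by rewrite det_diag; apply: eq_bigr => i _; rewrite mxE.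
  rewrite -det_mulmx mul_mx_diag; congr (\det _).
  by apply/matrixP => i j; rewrite !mxE; case: eqP => [->|]; rewrite ?mul1r ?mul0r ?mulr0n ?mulr1n.
have cE b : (compound k (diag_mx d) *m v) b ord0 = (\prod_i d ord0 (enum_val b i)) * v b ord0.
  rewrite mxE (bigD1 b) //= mxE dE det_sub1 eqxx mulr1 [X in _ + X]big1 ?addr0 // => c cb.
  by rewrite mxE dE det_sub1 eq_sym (negPf cb) mulr0 mul0r.
rewrite !plE mulr_sumr; apply: eq_bigr => b _.
by rewrite cE mulrA -dE' dE mulrA.
Qed.

End Plucker.

(** * The Richardson variety *)

Section Slice.

Definition tri (i j k : nat) : 'I_3 -> 'I_7 := fun x => inord (nth 0%N [:: i; j; k] x).

Lemma I3P (P : 'I_3 -> Prop) : P (inord 0) -> P (inord 1) -> P (inord 2) -> forall i, P i.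
Proof.
move=> P0 P1 P2 i; rewrite -(inord_val i).
by case: i => [[|[|[|//]]] Hi] /=.
Qed.

Lemma I7P (P : 'I_7 -> Prop) :
  P (inord 0) -> P (inord 1) -> P (inord 2) -> P (inord 3) -> P (inord 4) ->
  P (inord 5) -> P (inord 6) -> forall i, P i.
Proof.
move=> P0 P1 P2 P3 P4 P5 P6 i; rewrite -(inord_val i).
by case: i => [[|[|[|[|[|[|[|//]]]]]]] Hi] /=.
Qed.

Lemma big3 (V : Type) (idx : V) (op : Monoid.law idx) (F : 'I_3 -> V) :
  \big[op/idx]_i F i = op (F (inord 0)) (op (F (inord 1)) (F (inord 2))).
Proof.
rewrite !big_ord_recl big_ord0 Monoid.mulm1.
by congr (op (F _) (op (F _) (F _))); apply/val_inj; rewrite /= inordK.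
Qed.

Lemma big7 (V : Type) (idx : V) (op : Monoid.law idx) (F : 'I_7 -> V) :
  \big[op/idx]_i F i = op (F (inord 0)) (op (F (inord 1)) (op (F (inord 2))
    (op (F (inord 3)) (op (F (inord 4)) (op (F (inord 5)) (F (inord 6))))))).
Proof.
rewrite !big_ord_recl big_ord0 Monoid.mulm1.
by congr (op (F _) (op (F _) (op (F _) (op (F _) (op (F _) (op (F _) (F _)))))));
   apply/val_inj; rewrite /= inordK.
Qed.

Lemma tri_increasing i j k : (i < j < k)%N -> (k < 7)%N -> strictly_increasing (tri i j k).
Proof.
move=> /andP[ij jk] k7; have j7 := ltn_trans jk k7; have i7 := ltn_trans ij j7.
by apply: I3P; apply: I3P; rewrite /tri !inordK //= ?inordK // => _; exact: ltn_trans jk.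
Qed.

Lemma det3 (K : comPzRingType) (A : 'M[K]_3) :
  let a i j := A (inord i) (inord j) in
  \det A = a 0%N 0%N * (a 1%N 1%N * a 2%N 2%N - a 1%N 2%N * a 2%N 1%N)
         - a 0%N 1%N * (a 1%N 0%N * a 2%N 2%N - a 1%N 2%N * a 2%N 0%N)
         + a 0%N 2%N * (a 1%N 0%N * a 2%N 1%N - a 1%N 1%N * a 2%N 0%N).
Proof.
move=> a; have aE i j : A i j = a i j by rewrite /a !inord_val.
rewrite (expand_det_row _ ord0) !big_ord_recl big_ord0 /cofactor.
rewrite !(expand_det_row _ ord0) !big_ord_recl !big_ord0 /cofactor !det_mx11 !mxE !aE /= /bump /=.
rewrite /=; ring.
Qed.

Lemma minor3 (K : comPzRingType) (M : 'M[K]_(7, 3)) i j k :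
  let m i j := M (inord i) (inord j) in
  \det (rowsub (tri i j k) M)
         = m i 0%N * (m j 1%N * m k 2%N - m j 2%N * m k 1%N)
         - m i 1%N * (m j 0%N * m k 2%N - m j 2%N * m k 0%N)
         + m i 2%N * (m j 0%N * m k 1%N - m j 1%N * m k 0%N).
Proof. by move=> m; rewrite det3 !mxE /tri !inordK. Qed.

(** For (s, t) <> (0, 0), the 3-planes spanned by the columns of these matrices
    represent the torus orbits of semistable points. *)
Definition slice_mx (K : pzRingType) (s t : K) : 'M[K]_(7, 3) :=
  \matrix_(i, j) nth 0 (nth [::] [:: [:: 1; 1; 1; 0; 0; 0; 0];
                                     [:: 0; 0; 1; 1; 1; 0; 0];
                                     [:: 0; 0; 0; s; t; 1; 1]] j) i.

Lemma slice_mxE (K : pzRingType) (s t : K) i j : (i < 7)%N -> (j < 3)%N ->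
  slice_mx s t (inord i) (inord j) =
  nth 0 (nth [::] [:: [:: 1; 1; 1; 0; 0; 0; 0];
                      [:: 0; 0; 1; 1; 1; 0; 0];
                      [:: 0; 0; 0; s; t; 1; 1]] j) i.
Proof. by move=> i7 j3; rewrite mxE !inordK. Qed.

End Slice.

Section LinearAction.
Variables (K : closedFieldType).

(** The preimage of a closed set under g is cut out by the forms f o g. *)
Lemma closure_lmove n (S : set {vspace 'cV[K]_n}) (g : 'M[K]_n) : g \in unitmx ->
  S `<=` proj_space n -> (forall l, S l -> S (lmove g l)) ->
  forall l, zariski_closure S l -> zariski_closure S (lmove g l).
Proof.
move=> gu Sp Sg l cl Z [[FF [Fd ->]] SZ].
pose G := [tuple \sum_j g i j *: ('X_j : {mpoly K[n]}) | i < n].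
have Gd i : tnth G i \is 1.-homog.
  by rewrite tnth_mktuple; apply: rpred_sum => j _; apply: dhomogZ; exact: homogXU.
have Gv v : form_map G v = g *m v.
  apply/matrixP => i j; rewrite ord1 !mxE tnth_mktuple /pval raddf_sum /=.
  by apply: eq_bigr => j' _; rewrite mevalZ mevalXU.
have lp := closure_proj_space Sp cl; have [v v0 lE] := line_has lp.
have gv0 : g *m v != 0.
  by apply: contraNneq v0 => E; rewrite -(mulKmx gu v) E mulmx0.
split; first by rewrite lE lmove_line; exact: line_point.
move=> F w FF' ; rewrite lE lmove_line => wl; have [d FFd] := Fd _ FF'.
apply: (pval0_homog FFd gv0 wl); rewrite -Gv -pval_comp.
apply: (closure_vanish (homog_comp FFd Gd) Sp _ cl); last by rewrite lE memv_line.
move=> l' w' Sl' w'l'; rewrite pval_comp -/(form_map G w') Gv.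
have [_ /(_ F (g *m w') FF')] := SZ _ (Sg _ Sl'); apply.
by rewrite -[_ *m _](lfunE (mulmx g)) memv_img.
Qed.

Lemma compound_diag_wedge k n (d : 'rV[K]_n) (M : 'M[K]_(n, k)) :
  compound k (diag_mx d) *m wedge M = wedge (diag_mx d *m M).
Proof.
apply/matrixP => a j; rewrite ord1 -!pl_enum_val diag_compound !pl_wedge.
rewrite -[X in X * _](_ : \det (diag_mx (\row_i d ord0 (enum_val a i))) = _); last first.
  by rewrite det_diag; apply: eq_bigr => i _; rewrite mxE.
by rewrite -det_mulmx !mul_diag_mx; congr (\det _); apply/matrixP => i j'; rewrite !mxE.
Qed.

Lemma diag_compound_mx k n (d : 'rV[K]_n) :
  compound k (diag_mx d) = diag_mx (\row_(a < ext_dim k n) \prod_i d ord0 (enum_val a i)).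
Proof.
apply/matrixP => a b; rewrite [RHS]mxE mxE.
have := diag_compound d (delta_mx b ord0 : 'cV_(ext_dim k n)) (enum_val a).
rewrite !pl_enum_val -colE !mxE eqxx andbT => ->.
by case: eqP => [->|]; rewrite ?mulr1 ?mulr0 ?mulr1n ?mulr0n.
Qed.

Lemma torus_compound k n (t : 'M[K]_n) : torus K n t ->
  exists2 d, t = diag_mx d & compound k t \in unitmx.
Proof.
move=> [/is_diag_mxP tD t1].
pose d := \row_i t i i; have tE : t = diag_mx d.
  apply/matrixP => i j; rewrite !mxE; case: eqP => [->|/eqP ij]; first by rewrite mulr1n.
  by rewrite tD // mulr0n.
exists d => //; rewrite tE diag_compound_mx unitmxE det_diag unitfE.
apply/prodf_neq0 => a _; rewrite mxE; apply/prodf_neq0 => i _.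
move: t1; rewrite tE det_diag => t1; apply/eqP => d0.
by move/eqP: t1; rewrite (bigD1 (enum_val a i)) //= d0 mul0r eq_sym oner_eq0.
Qed.

End LinearAction.

Section Richardson.
Variable K : closedFieldType.
Local Notation vI := (tri 0 2 3).
Local Notation wI := (tri 2 4 6).
Local Notation pt := (@wedge K 3 7).
Local Notation line := {vspace 'cV[K]_(ext_dim 3 7)}.

Definition rich : set line := richardson K vI wI.

Lemma det3_block (A : 'M[K]_3) (r : 'I_3) :
  (forall i j : 'I_3, (r <= i)%N -> (j <= r)%N -> A i j = 0) -> \det A = 0.
Proof.
rewrite det3; move: r; apply: I3P => A0.
- by rewrite !(A0 _ (inord 0)) ?inordK //; ring.
- rewrite (A0 (inord 1) (inord 0)) ?(A0 (inord 1) (inord 1)) ?(A0 (inord 2) (inord 0))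
    ?(A0 (inord 2) (inord 1)) ?inordK //; ring.
- by rewrite !(A0 (inord 2)) ?inordK //; ring.
Qed.

Lemma increasing_leq (I : 'I_3 -> 'I_7) (i j : 'I_3) :
  strictly_increasing I -> (i <= j)%N -> (I i <= I j)%N.
Proof.
move=> inc; rewrite leq_eqVlt => /orP[/eqP/val_inj-> //|/inc]; exact: ltnW.
Qed.

Section Trig.
Variable w : 'I_3 -> 'I_7.
Hypothesis w_inc : strictly_increasing w.

Lemma trig_diag (g : 'M[K]_7) i : is_trig_mx g -> \det g = 1 -> g i i != 0.
Proof.
move=> gt; rewrite det_trig // => g1; apply/eqP => g0.
by move/eqP: g1; rewrite (bigD1 i) //= g0 mul0r eq_sym oner_eq0.
Qed.

Lemma opp_wedge0 g : @borel_opp K 7 g -> pt (colsub w g) != 0.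
Proof.
move=> [gt g1]; apply/eqP => E.
have /eqP : pl w (pt (colsub w g)) = 0.
  by rewrite E plE big1 // => b _; rewrite mxE mulr0.
rewrite pl_wedge det_trig; last first.
  apply/is_trig_mxP => i j ij; rewrite !mxE.
  by move/is_trig_mxP: gt; apply; exact: w_inc.
by apply/negP/prodf_neq0 => i _; rewrite !mxE trig_diag.
Qed.

Lemma borel_wedge0 g : @borel K 7 g -> pt (colsub w g) != 0.
Proof.
move=> [gt g1]; apply/eqP => E.
have /eqP : pl w (pt (colsub w g)) = 0.
  by rewrite E plE big1 // => b _; rewrite mxE mulr0.
rewrite pl_wedge -det_tr det_trig; last first.
  apply/is_trig_mxP => i j ij; rewrite !mxE.
  by move/is_trig_mxP: gt => /(_ _ _ (w_inc ij)); rewrite mxE.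
apply/negP/prodf_neq0 => i _; rewrite !mxE.
by have := @trig_diag g^T (w i) gt; rewrite det_tr mxE; apply.
Qed.

Lemma borel_minor0 g I r : @borel K 7 g -> strictly_increasing I -> (w r < I r)%N ->
  pl I (pt (colsub w g)) = 0.
Proof.
move=> [gt g1] inc wI; rewrite pl_wedge; apply: (@det3_block _ r) => i j ri jr.
rewrite !mxE; move/is_trig_mxP: gt => /(_ (w j) (I i)); rewrite mxE; apply.
exact: leq_trans (leq_ltn_trans (increasing_leq w_inc jr) wI) (increasing_leq inc ri).
Qed.

Lemma opp_minor0 g I r : @borel_opp K 7 g -> strictly_increasing I -> (I r < w r)%N ->
  pl I (pt (colsub w g)) = 0.
Proof.
move=> [gt g1] inc wI; rewrite pl_wedge -det_tr; apply: (@det3_block _ r) => i j ri jr.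
rewrite !mxE; move/is_trig_mxP: gt; apply.
exact: leq_trans (leq_ltn_trans (increasing_leq inc jr) wI) (increasing_leq w_inc ri).
Qed.

Lemma orbitE (H : set 'M[K]_7) l :
  [set lmove (compound 3 g) (e_point K w) | g in H] l <->
  exists2 g, H g & l = <[pt (colsub w g)]>%VS.
Proof. by split=> [[g Hg <-]|[g Hg ->]]; exists g; rewrite ?orbit_point. Qed.

End Trig.

Lemma vI_inc : strictly_increasing vI. Proof. exact: tri_increasing. Qed.
Lemma wI_inc : strictly_increasing wI. Proof. exact: tri_increasing. Qed.

Let orbw := [set lmove (compound 3 g) (e_point K wI) | g in @borel K 7].
Let orbv := [set lmove (compound 3 g) (e_point K vI) | g in @borel_opp K 7].

Lemma orbw_wedge l : orbw l -> exists2 M, pt M != 0 & l = <[pt M]>%VS.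
Proof.
move=> /(orbitE wI_inc)[g Bg ->]; exists (colsub wI g) => //.
exact: (borel_wedge0 wI_inc).
Qed.

Lemma orbv_wedge l : orbv l -> exists2 M, pt M != 0 & l = <[pt M]>%VS.
Proof.
move=> /(orbitE vI_inc)[g Bg ->]; exists (colsub vI g) => //.
exact: (opp_wedge0 vI_inc).
Qed.

Lemma orbw_proj : orbw `<=` proj_space _.
Proof. by move=> l /orbw_wedge[M M0 ->]; exact: line_point. Qed.

Lemma orbv_proj : orbv `<=` proj_space _.
Proof. by move=> l /orbv_wedge[M M0 ->]; exact: line_point. Qed.

Lemma rich_proj : rich `<=` proj_space _.
Proof. by move=> l [/(closure_proj_space orbw_proj)]. Qed.

Lemma rich_wedge l : rich l -> exists2 M, pt M != 0 & l = <[pt M]>%VS.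
Proof. by move=> [/(closure_decomposable orbw_wedge)]. Qed.

(** On the orbits, the coordinate with index set I is a minor with a block of
    zeros too large for it, unless I lies in the Bruhat interval. *)
Lemma rich_pl0 l I r u : rich l -> u \in l -> strictly_increasing I ->
  ((wI r < I r) || (I r < vI r))%N -> pl I u = 0.
Proof.
move=> [lw lv] ul inc /orP[] bad.
  apply: (closure_vanish (plform_homog K I) orbw_proj _ lw ul).
  move=> l' u' /(orbitE wI_inc)[g Bg ->] u'l.
  apply: (pval0_homog (plform_homog K I) (borel_wedge0 wI_inc Bg) u'l).
  exact: (borel_minor0 wI_inc Bg inc bad).
apply: (closure_vanish (plform_homog K I) orbv_proj _ lv ul).
move=> l' u' /(orbitE vI_inc)[g Bg ->] u'l.
apply: (pval0_homog (plform_homog K I) (opp_wedge0 vI_inc Bg) u'l).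
exact: (opp_minor0 vI_inc Bg inc bad).
Qed.

Lemma rich_curve (c : 'I_(ext_dim 3 7) -> {poly K}) (q : {poly K}) z0 :
  q != 0 -> curve_point c z0 != 0 ->
  (forall z, q.[z] != 0 -> curve_point c z != 0 -> rich <[curve_point c z]>%VS) ->
  rich <[curve_point c z0]>%VS.
Proof.
move=> q0 c0 cr; split=> Z [Zc SZ]; apply: (closed_curve Zc q0 c0) => z qz cz;
  have [lw lv] := cr z qz cz; [exact: lw|exact: lv].
Qed.

Lemma diag_borel d g : @borel K 7 g -> \det (diag_mx d) = 1 -> @borel K 7 (diag_mx d *m g).
Proof.
move=> [/is_trig_mxP gt g1] d1; split; last by rewrite det_mulmx d1 g1 mulr1.
by apply/is_trig_mxP => i j /gt; rewrite mul_diag_mx !mxE => ->; rewrite mulr0.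
Qed.

Lemma diag_borel_opp d g : @borel_opp K 7 g -> \det (diag_mx d) = 1 ->
  @borel_opp K 7 (diag_mx d *m g).
Proof.
move=> [/is_trig_mxP gt g1] d1; split; last by rewrite det_mulmx d1 g1 mulr1.
by apply/is_trig_mxP => i j /gt; rewrite mul_diag_mx !mxE => ->; rewrite mulr0.
Qed.

Lemma rich_torus l t : rich l -> torus K 7 t -> rich (lmove (compound 3 t) l).
Proof.
move=> [lw lv] Tt; have [d tE cu] := torus_compound 3 Tt; have [_ t1] := Tt.
rewrite tE in t1 cu *.
have mv (w : 'I_3 -> 'I_7) g : lmove (compound 3 (diag_mx d)) <[pt (colsub w g)]>%VS
    = <[pt (colsub w (diag_mx d *m g))]>%VS.
  rewrite lmove_line compound_diag_wedge; congr (<[wedge _]>%VS).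
  by apply/matrixP => i j; rewrite !mul_diag_mx !mxE.
split.
  apply: (closure_lmove cu orbw_proj _ lw) => l' /(orbitE wI_inc)[g Bg ->].
  by apply/(orbitE wI_inc); exists (diag_mx d *m g); [exact: diag_borel|rewrite mv].
apply: (closure_lmove cu orbv_proj _ lv) => l' /(orbitE vI_inc)[g Bg ->].
by apply/(orbitE vI_inc); exists (diag_mx d *m g); [exact: diag_borel_opp|rewrite mv].
Qed.

(** * The slice *)

Definition slice_pt (s t : K) := pt (slice_mx s t).

Lemma slice_pt0 s t : slice_pt s t != 0.
Proof.
apply/eqP => E; have /eqP : pl (tri 0 2 5) (slice_pt s t) = 0.
  by rewrite E plE big1 // => b _; rewrite mxE mulr0.
by rewrite pl_wedge minor3 !slice_mxE //= !(mul0r, mulr0, mul1r, subr0, addr0) oner_eq0.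
Qed.

Lemma wedge_curve (M : 'M[{poly K}]_(7, 3)) z :
  curve_point (fun a : 'I_(ext_dim 3 7) => \det (rowsub (enum_val a) M)) z
  = pt (map_mx (horner_eval z) M).
Proof.
apply/matrixP => a j; rewrite !mxE -[LHS]/(horner_eval z _) -det_map_mx.
by congr (\det _); apply/matrixP => i i'; rewrite !mxE.
Qed.

Lemma map_slice_mx (s t : {poly K}) z :
  map_mx (horner_eval z) (slice_mx s t) = slice_mx s.[z] t.[z].
Proof.
apply/matrixP; apply: I7P; apply: I3P;
  by rewrite !mxE !inordK //= /horner_eval ?horner0 ?hornerE.
Qed.

(** The columns of the slice matrix are the columns 2, 4, 6 of an upper triangular
    matrix, as their last nonzero entries are in these rows. *)
Lemma slice_schubert s t : @schubert K 3 7 wI <[slice_pt s t]>%VS.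
Proof.
apply: sub_closure; apply/(orbitE wI_inc).
pose g : 'M[K]_7 := \matrix_(i, j) if j == 2%N :> nat then slice_mx s t i (inord 0)
  else if j == 4%N :> nat then slice_mx s t i (inord 1)
  else if j == 6%N :> nat then slice_mx s t i (inord 2) else (i == j :> nat)%:R.
have gt : is_trig_mx g^T.
  by apply/is_trig_mxP; apply: I7P; apply: I7P; rewrite !mxE !inordK.
exists g.
  split=> //; rewrite -det_tr det_trig // big7 !mxE !inordK //=.
  by rewrite !mulr1.
congr (<[wedge _]>%VS); apply/matrixP => i; apply: I3P;
  by rewrite !mxE /tri !inordK.
Qed.

(** For s <> 0 the columns of the slice matrix are the columns 0, 2, 3 of a lower
    triangular matrix, whose determinant is corrected in column 6; the points
    with s = 0 are limits of these. *)
Lemma slice_schubert_opp s t : @schubert_opp K 3 7 vI <[slice_pt s t]>%VS.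
Proof.
have gen s' : s' != 0 -> orbv <[slice_pt s' t]>%VS.
  move=> s0; apply/(orbitE vI_inc).
  pose g : 'M[K]_7 := \matrix_(i, j) if j == 0%N :> nat then slice_mx s' t i (inord 0)
    else if j == 2%N :> nat then slice_mx s' t i (inord 1)
    else if j == 3%N :> nat then slice_mx s' t i (inord 2)
    else if j == 6%N :> nat then (i == 6%N :> nat)%:R / s' else (i == j :> nat)%:R.
  have gt : is_trig_mx g.
    by apply/is_trig_mxP; apply: I7P; apply: I7P; rewrite !mxE !inordK //= ?mul0r.
  exists g.
    split=> //; rewrite det_trig // big7 !mxE !inordK //=.
    by rewrite !mul1r divff.
  congr (<[wedge _]>%VS); apply/matrixP => i; apply: I3P;
    by rewrite !mxE /tri !inordK.
pose c (a : 'I_(ext_dim 3 7)) : {poly K} := \det (rowsub (enum_val a) (slice_mx ('X : {poly K}) t%:P)).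
have cE z : curve_point c z = slice_pt z t.
  by rewrite wedge_curve map_slice_mx hornerX hornerC.
move=> Z [Zc SZ].
suff : Z <[curve_point c s]>%VS by rewrite cE.
apply: (closed_curve Zc (negbT (polyX_eq0 K))); first by rewrite cE slice_pt0.
by move=> z; rewrite hornerX cE => z0 _; apply/SZ/gen.
Qed.

Lemma slice_rich s t : rich <[slice_pt s t]>%VS.
Proof. by split; [exact: slice_schubert|exact: slice_schubert_opp]. Qed.

End Richardson.

(** * Semistability *)

Section Stability.
Variable K : closedFieldType.
Local Notation pt := (@wedge K 3 7).
Local Notation line := {vspace 'cV[K]_(ext_dim 3 7)}.
Local Notation X := (@rich K).

Definition ext_torus : set 'M[K]_(ext_dim 3 7) := [set compound 3 t | t in torus K 7].

Lemma inv_off e s (l : line) v : inv_sections ext_torus X e s ->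
  (v \notin l) || (v == 0) -> s l v = 0.
Proof.
move=> [sX s0 _] vl; have [Xl|nX] := pselect (X l); last by rewrite s0.
by have [-> //] := sX l Xl.
Qed.

Lemma inv_homog e s (l : line) a v : inv_sections ext_torus X e s -> a != 0 ->
  s l (a *: v) = a ^+ e * s l v.
Proof.
move=> [sX s0 _] a0; have [Xl|nX] := pselect (X l); last by rewrite s0 ?mulr0.
by have [_ -> //] := sX l Xl.
Qed.

Lemma inv_move e s (l : line) t v : inv_sections ext_torus X e s -> X l -> torus K 7 t ->
  s (lmove (compound 3 t) l) (compound 3 t *m v) = s l v.
Proof.
move=> [_ _ sT] Xl Tt; have [d tE cu] := torus_compound 3 Tt.
by rewrite sT ?/smove ?mulKmx //; exists t.
Qed.

(** A section invariant under the torus vanishes at l as soon as some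
    one-parameter subgroup multiplies all coordinates of l by positive powers of
    its parameter: the lines tend to a point of X when the parameter tends to 0,
    near which the section is a fraction of forms, while the vectors tend to 0.
    Here the subgroup acts by z^(7 - |J|) on the coordinates in J and by
    z^(- |J|) on the others, so that the coordinate with index set I gets the
    exponent 7 |I inter J| - 3 |J|. *)
Lemma semistable_meets m s v M (J : {set 'I_7}) k :
  inv_sections ext_torus X (m * 7) s -> (0 < m)%N -> s <[pt M]>%VS v != 0 ->
  (3 * #|J| < 7 * k)%N ->
  exists2 a : 'I_(ext_dim 3 7), pt M a ord0 != 0 & (#|[pred i | enum_val a i \in J]| < k)%N.
Proof.
move=> sinv m0 sv Jk; set p := pt M; set l := <[p]>%VS.
have Xl : X l by apply: contrapT => nX; move: sv; case: sinv => _ -> //; rewrite eqxx.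
pose N (a : 'I_(ext_dim 3 7)) := #|[pred i | enum_val a i \in J]|.
have p0 : p != 0.
  apply: contraNneq sv => p0; apply/eqP; apply: (inv_off sinv).
  by rewrite /l (p0 : pt M = 0); case: vlineP => // -[a ->]; rewrite scaler0 eqxx.
have sp : s l p != 0.
  apply: contraNneq sv => sp.
  have [/(inv_off sinv) -> //|] := boolP ((v \notin l) || (v == 0)).
  rewrite negb_or negbK => /andP[/vlineP[a ->]]; rewrite scaler_eq0 negb_or => /andP[a0 _].
  by rewrite (inv_homog _ _ sinv a0) sp mulr0.
have [a1 [j pa1]] := matrix0Pn _ p0; rewrite ord1 in pa1.
case: (@arg_minnP _ a1 (fun a => p a ord0 != 0) N pa1) => a0 pa0 a0min.
apply: contrapT => nex; have kN : (k <= N a0)%N.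
  by rewrite leqNgt; apply/negP => Nk; apply: nex; exists a0.
have j7 : (#|J| <= 7)%N by have := max_card (mem J); rewrite card_ord.
(* The lowest exponent e is split off, so that the curve c reaches a nonzero
   vector at 0. *)
pose e := (7 * N a0 - 3 * #|J|)%N.
have e0 : (0 < e)%N by rewrite subn_gt0 (leq_trans Jk) // leq_mul2l.
pose c a : {poly K} := p a ord0 *: 'X^(7 * (N a - N a0)).
have cn0 z : curve_point c z != 0.
  apply: contraNneq pa0 => /matrixP/(_ a0 ord0).
  by rewrite [LHS]mxE [RHS]mxE hornerZ subnn muln0 expr0 hornerC mulr1 => ->.
pose d z : 'rV[K]_7 := \row_j (if j \in J then z ^+ (7 - #|J|) else z ^- #|J|).
have Td z : z != 0 -> torus K 7 (diag_mx (d z)).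
  move=> z0; split; first exact: diag_mx_is_diag.
  rewrite det_diag; under eq_bigr => i _ do rewrite mxE.
  rewrite (bigID (mem J)) /=.
  rewrite (eq_bigr (fun=> z ^+ (7 - #|J|))) => [|i ->//].
  rewrite [X in _ * X](eq_bigr (fun=> z ^- #|J|)) => [|i /negPf->//].
  rewrite !prodr_const -exprVn -!exprM.
  have -> : #|[pred i | i \notin J]| = (7 - #|J|)%N by have := cardC (mem J); rewrite card_ord => /(canRL (addKn _)).
  by rewrite [(#|J| * _)%N]mulnC exprVn divff // expf_neq0.
have dc z : z != 0 -> compound 3 (diag_mx (d z)) *m p = z ^+ e *: curve_point c z.
  move=> z0; apply/matrixP => a j'; rewrite ord1 -pl_enum_val diag_compound pl_enum_val.
  rewrite [RHS]mxE [curve_point c z a _]mxE hornerZ hornerXn [RHS]mulrCA -exprD mulrC.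
  have [->|pa] := eqVneq (p a ord0) 0; first by rewrite !mul0r.
  congr (_ * _); have z3 : z ^+ (3 * #|J|) != 0 by rewrite expf_neq0.
  apply: (mulIf z3); rewrite -exprD.
  have -> : (e + 7 * (N a - N a0) + 3 * #|J| = 7 * N a)%N.
    rewrite /e addnAC subnK ?(ltnW (leq_trans Jk _)) ?leq_mul2l //.
    by rewrite -mulnDr subnKC // a0min.
  have -> : z ^+ (3 * #|J|) = \prod_(i < 3) z ^+ #|J|.
    by rewrite prodr_const card_ord -exprM mulnC.
  rewrite -big_split /=.
  rewrite (eq_bigr (fun i => if enum_val a i \in J then z ^+ 7 else 1)); last first.
    move=> i _; rewrite mxE; case: ifP => _; first by rewrite -exprD subnK.
    by rewrite mulVf // expf_neq0.
  rewrite -big_mkcond /= prodr_const exprM; congr (_ ^+ _).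
have lc z : z != 0 -> lmove (compound 3 (diag_mx (d z))) l = <[curve_point c z]>%VS.
  move=> z0; rewrite lmove_line dc //.
  have ze : z ^+ e != 0 by rewrite expf_neq0.
  apply: (lineE _ _ (cn0 z)).
    by apply: line_point; rewrite scaler_eq0 negb_or ze cn0.
  by apply/vlineP; exists (z ^+ e)^-1; rewrite scalerK.
have Xc z : z != 0 -> X <[curve_point c z]>%VS.
  by move=> z0; rewrite -lc //; apply: rich_torus Xl _; exact: Td.
have Xc0 : X <[curve_point c 0]>%VS.
  apply: (rich_curve (negbT (polyX_eq0 K)) (cn0 0)) => z; rewrite hornerX => z0 _; exact: Xc.
have [sX _ _] := sinv.
have [f [g [q [g0 q0 E]]]] := section_curve (@rich_proj K) sX (cn0 0) Xc0.
have sc z : z != 0 -> z ^+ (e * (m * 7)) * s <[curve_point c z]>%VS (curve_point c z) = s l p.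
  move=> z0; rewrite exprM -(inv_homog _ _ sinv) ?expf_neq0 //.
  by rewrite -dc // -lc // (inv_move _ sinv Xl (Td _ z0)).
have : 'X^(e * (m * 7)) * f = s l p *: g.
  apply: (@poly_eq_off_roots _ _ _ (q * 'X)).
    by rewrite mulf_neq0 ?polyX_eq0 //; apply: contraNneq q0 => ->; rewrite horner0.
  move=> z; rewrite hornerM hornerX mulf_eq0 negb_or => /andP[qz z0].
  rewrite hornerM hornerXn hornerZ -E //; last exact: Xc.
  by rewrite mulrA sc.
move=> /(congr1 (fun h => h.[0])); rewrite hornerM hornerXn hornerZ expr0n.
rewrite (_ : (_ == 0%N) = false); last by apply/negbTE; rewrite !muln_eq0 !negb_or -!lt0n e0 m0.
by rewrite mul0r => /eqP; rewrite eq_sym mulf_eq0 (negPf sp) (negPf g0).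
Qed.

End Stability.

Section StableMatrices.
Variable K : closedFieldType.
Local Notation pt := (@wedge K 3 7).

Lemma nth_root (n : nat) (c : K) : (0 < n)%N -> exists z, z ^+ n = c.
Proof.
move=> n0; have /closed_rootP[z] : size ('X^n - c%:P) != 1%N.
  by rewrite size_XnsubC // eqSS -lt0n.
by rewrite /root hornerD hornerN hornerXn hornerC subr_eq0 => /eqP; exists z.
Qed.

Lemma wedge_mulmx k n (A : 'M[K]_(n, k)) (B : 'M[K]_k) : wedge (A *m B) = \det B *: wedge A.
Proof.
apply/matrixP => i j; rewrite mxE [RHS]mxE [X in _ * X]mxE mulrC -det_mulmx.
by congr (\det _); apply/matrixP => r l; rewrite !mxE; apply: eq_bigr => m _; rewrite !mxE.
Qed.

Lemma minors_kernel p (A : 'M[K]_(p, 3)) :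
  (forall f : 'I_3 -> 'I_p, strictly_increasing f -> \det (rowsub f A) = 0) ->
  exists2 c : 'cV[K]_3, c != 0 & A *m c = 0.
Proof.
move=> A0; have [fA|nfA] := boolP (row_full A).
  have [s [J [incJ IJ]]] := injective_sort (@fullrankfun_inj _ _ _ A fA).
  have := fullrowsub_unit fA; rewrite unitmxE unitfE.
  rewrite (_ : rowsub _ _ = row_perm s (rowsub J A)); last first.
    by apply/matrixP => i j; rewrite !mxE IJ.
  by rewrite row_permE det_mulmx A0 // mulr0 eqxx.
have : kermx A^T != 0.
  rewrite kermx_eq0 -row_leq_rank mxrank_tr -ltnNge ltn_neqAle rank_leq_col.
  by rewrite andbT; exact: nfA.
move=> /rowV0Pn[v /sub_kermxP vA v0]; exists v^T.
  by apply: contraNneq v0 => E; rewrite -[v]trmxK E trmx0.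
by rewrite -[A]trmxK -trmx_mul vA trmx0.
Qed.

Lemma rowsub_kernel p (M : 'M[K]_(7, 3)) (f : 'I_p -> 'I_7) :
  (forall g : 'I_3 -> 'I_p, strictly_increasing g -> \det (rowsub (f \o g) M) = 0) ->
  exists2 c : 'cV[K]_3, c != 0 & forall i, (M *m c) (f i) ord0 = 0.
Proof.
move=> M0; have [g inc|c c0 E] := minors_kernel (A := rowsub f M).
  rewrite (_ : rowsub g _ = rowsub (f \o g) M) ?M0 //.
  by apply/matrixP => i j; rewrite !mxE.
exists c => // i; move/matrixP/(_ i ord0): E; rewrite !mxE => E.
by rewrite -[RHS]E; apply: eq_bigr => j _; rewrite mxE.
Qed.

Section Stable.
Variable M : 'M[K]_(7, 3).
Hypothesis stable : forall (J : {set 'I_7}) k, (3 * #|J| < 7 * k)%N ->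
  exists I : 'I_3 -> 'I_7, \det (rowsub I M) != 0 /\ (#|[pred i | I i \in J]| < k)%N.
Hypothesis vanish : forall (I : 'I_3 -> 'I_7) r, strictly_increasing I ->
  ((tri 2 4 6 r < I r) || (I r < tri 0 2 3 r))%N -> \det (rowsub I M) = 0.
Implicit Types (c : 'cV[K]_3) (rs : seq nat).

Definition supported c rs := forall i : 'I_7, (i : nat) \notin rs -> (M *m c) i ord0 = 0.

Lemma card_rows rs : (#|[set i : 'I_7 | (i : nat) \in rs]%SET| <= size rs)%N.
Proof.
rewrite cardE -(size_map val); apply: uniq_leq_size.
  by rewrite map_inj_uniq ?enum_uniq //; exact: val_inj.
by move=> _ /mapP[i + ->]; rewrite mem_enum inE.
Qed.

Lemma det_kernel (I : 'I_3 -> 'I_7) c : \det (rowsub I M) != 0 ->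
  (forall i, (M *m c) (I i) ord0 = 0) -> c = 0.
Proof.
move=> IM E; have Mu : rowsub I M \in unitmx by rewrite unitmxE unitfE.
rewrite -(mulKmx Mu c) (_ : rowsub I M *m c = 0) ?mulmx0 //.
apply/matrixP => i j; rewrite ord1 [RHS]mxE -(E i) !mxE.
by apply: eq_bigr => k _; rewrite mxE.
Qed.

(** The column space meets a coordinate subspace of dimension r in dimension at
    most 3 r / 7: in dimension 0 for r <= 2, and at most 1 for r <= 4. *)
Lemma no_vector c rs : supported c rs -> (size rs <= 2)%N -> c = 0.
Proof.
move=> sup rs2; have [|I [IM I0]] := stable (J := [set i : 'I_7 | (i : nat) \in rs]%SET) (k := 1).
  by apply: (@leq_ltn_trans (3 * 2)) => //; rewrite leq_mul2l (leq_trans (card_rows _)).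
apply: (det_kernel IM) => i; apply: sup; apply/negP => Ii.
move: I0; rewrite ltnS leqn0 => /eqP/card0_eq/(_ i).
by rewrite !inE Ii.
Qed.

Lemma no_plane c c' rs : supported c rs -> supported c' rs -> (size rs <= 4)%N ->
  exists a b, ((a != 0) || (b != 0)) /\ a *: c + b *: c' = 0.
Proof.
move=> sup sup' rs4; have [|I [IM I1]] := stable (J := [set i : 'I_7 | (i : nat) \in rs]%SET) (k := 2).
  by apply: (@leq_ltn_trans (3 * 4)) => //; rewrite leq_mul2l (leq_trans (card_rows _)).
have [c0|c0] := eqVneq c 0.
  by exists 1, 0; rewrite oner_eq0 c0 scaler0 scale0r addr0.
have [i0 i0P] : exists i, (M *m c) (I i) ord0 != 0.
  apply: contrapT => nx; move/eqP: c0; apply; apply: (det_kernel IM) => i.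
  by apply/eqP; apply: contrapT => /negP ci; apply: nx; exists i.
have in_rs c1 i : supported c1 rs -> (M *m c1) (I i) ord0 != 0 -> (I i : nat) \in rs.
  by move=> s1; apply: contraNT => /s1 ->.
have off c1 i : supported c1 rs -> i != i0 -> (M *m c1) (I i) ord0 = 0.
  move=> s1 ii0; apply/eqP; apply: contraNT ii0 => /(in_rs _ _ s1) Ii.
  have /card_le1_eqP E := I1; apply/eqP; apply: E; rewrite !inE //.
  exact: in_rs sup i0P.
exists (- (M *m c') (I i0) ord0), ((M *m c) (I i0) ord0); split.
  by rewrite i0P orbT.
apply: (det_kernel IM) => i; rewrite mulmxDr -!scalemxAr.
rewrite mxE [X in X + _]mxE [X in _ + X]mxE.
have [->|ii0] := eqVneq i i0; first by rewrite mulNr mulrC addNr.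
by rewrite (off c i sup ii0) (off c' i sup' ii0) !mulr0 addr0.
Qed.

(** By the vanishing of the minors outside the Bruhat interval, the column space
    contains vectors supported in rows 0-2, 2-4 and 3-6. Stability forbids
    further zeros, except for one of the entries 3 and 4 of the last vector, and
    this leaves the torus orbit of a slice matrix. *)
Lemma stable_slice : exists (d : 'rV[K]_7) (s t : K),
  [/\ \det (diag_mx d) = 1, (s != 0) || (t != 0)
    & exists2 e, e != 0 & pt M = e *: pt (diag_mx d *m slice_mx s t)].
Proof.
have ker (rs rs' : seq nat) : (forall i : 'I_7, ((i : nat) \in rs) || ((i : nat) \in rs')) ->
    sorted ltn rs' -> all (fun i => i < 7)%N rs' ->
    (forall I : 'I_3 -> 'I_7, strictly_increasing I -> (forall i, (I i : nat) \in rs') ->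
       \det (rowsub I M) = 0) ->
    exists2 c, c != 0 & supported c rs.
  move=> cov so bd D; pose f (i : 'I_(size rs')) : 'I_7 := inord (nth 0%N rs' i).
  have f7 (i : 'I_(size rs')) : (nth 0%N rs' i < 7)%N by apply: (allP bd); rewrite mem_nth.
  have [g inc|c c0 E] := @rowsub_kernel _ M f.
    apply: D => [i j /inc ij|i]; last by rewrite /f /= inordK // mem_nth.
    by rewrite /f /= !inordK //; apply: (sorted_ltn_nth ltn_trans _ so) => //; rewrite inE.
  exists c => // i irs; have := cov i; rewrite (negPf irs) /= => irs'.
  have ii : (index (i : nat) rs' < size rs')%N by rewrite index_mem.
  have := E (Ordinal ii); rewrite /f /= nth_index //.
  by rewrite inord_val.
have bnd (I : 'I_3 -> 'I_7) : strictly_increasing I ->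
    [/\ (I (inord 0) < I (inord 1))%N, (I (inord 1) < I (inord 2))%N & (I (inord 2) < 7)%N].
  by move=> inc; split=> //; apply: inc; rewrite !inordK.
have [c1 c10 S1] : exists2 c, c != 0 & supported c [:: 0; 1; 2].
  apply: (ker _ [:: 3; 4; 5; 6]) => //; first by apply: I7P; rewrite inordK.
  move=> I inc mem; apply: (vanish (r := inord 0) inc); rewrite /tri !inordK //=.
  by have := mem (inord 0); rewrite !inE; case: (nat_of_ord (I _)) => [|[|[|]]].
have [c2 c20 S2] : exists2 c, c != 0 & supported c [:: 2; 3; 4].
  apply: (ker _ [:: 0; 1; 5; 6]) => //; first by apply: I7P; rewrite inordK.
  move=> I inc mem; apply: (vanish (r := inord 1) inc); rewrite /tri !inordK //=.
  have [] := bnd I inc; have := mem (inord 1); rewrite !inE.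
  by case: (nat_of_ord (I (inord 1))) => [|[|[|[|[|]]]]].
have [c3 c30 S3] : exists2 c, c != 0 & supported c [:: 3; 4; 5; 6].
  apply: (ker _ [:: 0; 1; 2]) => //; first by apply: I7P; rewrite inordK.
  move=> I inc mem; apply: (vanish (r := inord 2) inc); rewrite /tri !inordK //=.
  by have := mem (inord 2); rewrite !inE; case: (nat_of_ord (I _)) => [|[|[|]]].
pose u c i := (M *m c) (inord i) ord0.
have uE c i : (M *m c) i ord0 = u c i by rewrite /u inord_val.
have nz c rs i : c != 0 -> supported c rs -> i \in rs -> (size (rem i rs) <= 2)%N ->
    uniq rs -> (i < 7)%N -> u c i != 0.
  move=> c0 S irs r2 ur i7; apply: contraNneq c0 => ci.
  apply/eqP; apply: (@no_vector c (rem i rs)) => // j.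
  rewrite mem_rem_uniq // inE negb_and negbK => /orP[/eqP ji|/S //].
  by rewrite uE ji.
have a0 : u c1 0 != 0 by apply: (nz _ _ _ c10 S1).
have a1 : u c1 1 != 0 by apply: (nz _ _ _ c10 S1).
have a2 : u c1 2 != 0 by apply: (nz _ _ _ c10 S1).
have b2 : u c2 2 != 0 by apply: (nz _ _ _ c20 S2).
have b3 : u c2 3 != 0 by apply: (nz _ _ _ c20 S2).
have b4 : u c2 4 != 0 by apply: (nz _ _ _ c20 S2).
have z c rs i : supported c rs -> i \notin rs -> (i < 7)%N -> u c i = 0.
  by move=> S irs i7; apply: S; rewrite inordK.
have uD a c b c' i : u (a *: c + b *: c') i = a * u c i + b * u c' i.
  by rewrite /u mulmxDr -!scalemxAr !mxE.
have c5n i : (i == 5)%N || (i == 6)%N -> u c3 i != 0.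
  move=> i56; apply/eqP => ci.
  have [||//|a [b [ab E]]] := @no_plane c2 c3 (rem i [:: 2; 3; 4; 5; 6]%N).
  - move=> j jr; apply: S2; apply: contra jr; rewrite mem_rem_uniq // !inE.
    by case/orP: i56 => /eqP ->; case/or3P => /eqP ->.
  - move=> j; rewrite mem_rem_uniq // inE negb_and negbK => /orP[/eqP ji|jr].
      by rewrite uE ji.
    by apply: S3; apply: contra jr; rewrite !inE => /orP[->|/orP[->|/orP[->|->]]]; rewrite ?orbT.
  - by case/orP: i56 => /eqP ->.
  have := congr1 (fun c => u c 2) E; rewrite /= uD (z _ _ _ S3) // mulr0 addr0 {2}/u mulmx0 mxE.
  move=> /eqP; rewrite mulf_eq0 (negPf b2) orbF => /eqP a0'.
  move: ab E; rewrite a0' eqxx /= scale0r add0r => b0 /eqP.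
  by rewrite scaler_eq0 (negPf b0) (negPf c30).
have c5 : u c3 5 != 0 by exact: c5n.
have c6 : u c3 6 != 0 by exact: c5n.
have c34 : (u c3 3 != 0) || (u c3 4 != 0).
  rewrite -negb_and; apply: contra c30 => /andP[/eqP c3' /eqP c4'].
  apply/eqP; apply: (@no_vector c3 [:: 5; 6]) => // j; rewrite !inE negb_or => /andP[j5 j6].
  have [j3|j3] := eqVneq (j : nat) 3%N; first by rewrite uE j3.
  have [j4|j4] := eqVneq (j : nat) 4%N; first by rewrite uE j4.
  by apply: S3; rewrite !inE (negPf j3) (negPf j4) (negPf j5) (negPf j6).
pose G : 'M[K]_3 := \matrix_(i, j) nth 0 [:: c1; c2; c3] j i ord0.
have MG i j : (M *m G) (inord i) (inord j) = u (nth 0 [:: c1; c2; c3] (inord j : 'I_3)) i.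
  by rewrite /u !mxE; apply: eq_bigr => k _; rewrite !mxE.
have G0 : \det G != 0.
  have [detG|//] := eqVneq (\det G) 0.
  have /det0P[v v0 vG] : \det G^T == 0 by rewrite det_tr detG.
  move/eqP: v0; case.
  have Gv : G *m v^T = 0 by rewrite -[G]trmxK -trmx_mul vG trmx0.
  have uv i : u c1 i * v ord0 (inord 0) + (u c2 i * v ord0 (inord 1) + u c3 i * v ord0 (inord 2)) = 0.
    have := congr1 (fun x => (M *m x) (inord i) ord0) Gv.
    rewrite mulmx0 mulmxA mxE [X in _ = X]mxE big3 !MG !inordK // => E.
    by rewrite -[RHS]E !mxE.
  have v1 : v ord0 (inord 0) = 0.
    have := uv 0%N; rewrite (z _ _ _ S2) // (z _ _ _ S3) // !mul0r !addr0 => /eqP.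
    by rewrite mulf_eq0 (negPf a0) => /eqP.
  have v2 : v ord0 (inord 1) = 0.
    have := uv 2%N; rewrite v1 (z _ _ _ S3) // !(mul0r, mulr0) addr0 add0r => /eqP.
    by rewrite mulf_eq0 (negPf b2) => /eqP.
  have v3 : v ord0 (inord 2) = 0.
    have := uv 5%N; rewrite v1 v2 !(mul0r, mulr0) !add0r => /eqP.
    by rewrite mulf_eq0 (negPf c5) => /eqP.
  by apply/matrixP => i; rewrite ord1; apply: I3P; rewrite mxE.
(* The row scalings ds and the column scalings 1, r1, r2 carry a slice matrix to
   M G; the square of r2 is chosen to give ds the product 1. *)
pose r1 := u c2 2 / u c1 2; have r10 : r1 != 0 by rewrite mulf_neq0 // invr_eq0.
have [r2 r2E] := @nth_root 2 (u c1 0 * u c1 1 * u c1 2 * u c2 3 * u c2 4 * u c3 5 * u c3 6 / r1 ^+ 2) isT.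
have r20 : r2 != 0.
  have : r2 ^+ 2 != 0 by rewrite r2E !mulf_neq0 // invr_eq0 expf_neq0.
  by rewrite expf_eq0.
pose ds := [:: u c1 0; u c1 1; u c1 2; u c2 3 / r1; u c2 4 / r1; u c3 5 / r2; u c3 6 / r2].
exists (\row_j nth 0 ds j), (u c3 3 / (u c2 3 / r1 * r2)), (u c3 4 / (u c2 4 / r1 * r2)); split.
- rewrite det_diag big7 !mxE !inordK //=.
  have -> : u c1 0 * (u c1 1 * (u c1 2 * (u c2 3 / r1 * (u c2 4 / r1 * (u c3 5 / r2 * (u c3 6 / r2))))))
     = (u c1 0 * u c1 1 * u c1 2 * u c2 3 * u c2 4 * u c3 5 * u c3 6 / r1 ^+ 2) / r2 ^+ 2.
    by field; rewrite r10 r20.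
  by rewrite -r2E divff // expf_neq0.
- rewrite !mulf_eq0 !invr_eq0 !mulf_eq0 !invr_eq0 (negPf b3) (negPf b4) (negPf r10) (negPf r20).
  by rewrite !orbF.
have z1 : (u c1 3 = 0) * (u c1 4 = 0) * (u c1 5 = 0) * (u c1 6 = 0).
  by do !split; apply: (z _ _ _ S1).
have z2 : (u c2 0 = 0) * (u c2 1 = 0) * (u c2 5 = 0) * (u c2 6 = 0).
  by do !split; apply: (z _ _ _ S2).
have z3 : (u c3 0 = 0) * (u c3 1 = 0) * (u c3 2 = 0).
  by do !split; apply: (z _ _ _ S3).
pose rho : 'rV[K]_3 := \row_j nth 0 [:: 1; r1; r2] j.
have E : M *m G = diag_mx (\row_j nth 0 ds j) *m
    slice_mx (u c3 3 / (u c2 3 / r1 * r2)) (u c3 4 / (u c2 4 / r1 * r2)) *m diag_mx rho.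
  apply/matrixP; apply: I7P; apply: I3P; rewrite MG mul_mx_diag mul_diag_mx !mxE !inordK //=;
    rewrite ?z1 ?z2 ?z3;
    rewrite ?mulr0 ?mul0r ?mulr1 // /r1; field; rewrite ?a2 ?b2 ?r20 ?b3 ?b4 //.
exists ((\det G)^-1 * \det (diag_mx rho)).
  rewrite mulf_neq0 ?invr_eq0 // det_diag big3 !mxE !inordK //=.
  by rewrite mul1r mulf_neq0.
by rewrite -scalerA -wedge_mulmx -E wedge_mulmx scalerK.
Qed.

End Stable.

End StableMatrices.

(** * Invariant sections *)

Section InvariantSections.
Variable K : closedFieldType.
Local Notation pt := (@wedge K 3 7).
Local Notation line := {vspace 'cV[K]_(ext_dim 3 7)}.
Local Notation X := (@rich K).
Local Notation T := (@ext_torus K).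
Implicit Types (u : 'cV[K]_2) (l : line) (s : line -> 'cV[K]_(ext_dim 3 7) -> K).

Definition slice_vec u := slice_pt (u i0 ord0) (u i1 ord0).

Lemma slice_vec0 u : slice_vec u != 0. Proof. exact: slice_pt0. Qed.

(** The rows I with nonzero minor found by the numerical criterion are exactly
    what the stability of a matrix asks for. *)
Lemma inv_nonzero_orbit m s l v :
  inv_sections T X (m * 7) s -> (0 < m)%N -> s l v != 0 ->
  exists t u, [/\ torus K 7 t, u != 0 & l = lmove (compound 3 t) <[slice_vec u]>%VS].
Proof.
move=> sinv m0 sv.
have Xl : X l by apply: contrapT => nX; move: sv; case: sinv => _ -> //; rewrite eqxx.
have [M M0 lE] := rich_wedge Xl.
have [||d [s1 [t1 [d1 st [e e0 ME]]]]] := @stable_slice K M.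
- move=> J k Jk; rewrite lE in sv.
  have [a Ma aJ] := semistable_meets sinv m0 sv Jk.
  by exists (enum_val a); rewrite mxE in Ma.
- move=> I r inc bad; rewrite -pl_wedge.
  by apply: (rich_pl0 Xl _ inc bad); rewrite lE memv_line.
pose u : 'cV[K]_2 := \col_i nth 0 [:: s1; t1] i.
have us : slice_vec u = slice_pt s1 t1 by rewrite /slice_vec !mxE.
exists (diag_mx d), u; split.
- by split => //; exact: diag_mx_is_diag.
- apply: contraTneq st => u0; have := congr1 (fun w : 'cV_2 => w i0 ord0) u0.
  have := congr1 (fun w : 'cV_2 => w i1 ord0) u0; rewrite !mxE /= => -> ->.
  by rewrite eqxx.
rewrite us lmove_line compound_diag_wedge lE; apply: lineE.
- exact: line_point.
- by rewrite -[X in X \in _](scalerK e0) -ME rpredZ // memv_line.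
- by apply: contraNneq M0; rewrite ME => ->; rewrite scaler0.
Qed.

(** The two generators of the ring of invariants. In either of them every column
    index 0, ..., 6 occurs three times, so that both have weight zero. *)
Definition xform : {mpoly K[ext_dim 3 7]} :=
  plform K (tri 0 2 3) * plform K (tri 2 3 5) * plform K (tri 0 2 5)
  * plform K (tri 0 3 5) * plform K (tri 1 4 6) ^+ 3.
Definition yform : {mpoly K[ext_dim 3 7]} :=
  plform K (tri 0 2 4) * plform K (tri 2 3 5) * plform K (tri 0 2 5)
  * plform K (tri 0 3 5) * plform K (tri 1 3 6) * plform K (tri 1 4 6) ^+ 2.
Definition xyform : 2.-tuple {mpoly K[ext_dim 3 7]} := [tuple xform; yform].

Lemma xy0 : tnth xyform i0 = xform. Proof. by []. Qed.
Lemma xy1 : tnth xyform i1 = yform. Proof. by []. Qed.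

Lemma xyform_homog i : tnth xyform i \is 7.-homog.
Proof.
have P := @plform_homog K 3 7.
move: i; apply: I2P.
  exact: (dhomogM (dhomogM (dhomogM (dhomogM (P _) (P _)) (P _)) (P _)) (dhomogMn 3 (P _))).
exact: (dhomogM (dhomogM (dhomogM (dhomogM (dhomogM (P _) (P _)) (P _)) (P _)) (P _))
  (dhomogMn 2 (P _))).
Qed.

Lemma pval_xform v : pval xform v =
  pl (tri 0 2 3) v * pl (tri 2 3 5) v * pl (tri 0 2 5) v * pl (tri 0 3 5) v * pl (tri 1 4 6) v ^+ 3.
Proof. by rewrite pvalM pvalX !pvalM. Qed.

Lemma pval_yform v : pval yform v =
  pl (tri 0 2 4) v * pl (tri 2 3 5) v * pl (tri 0 2 5) v * pl (tri 0 3 5) v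
  * pl (tri 1 3 6) v * pl (tri 1 4 6) v ^+ 2.
Proof. by rewrite pvalM pvalX !pvalM. Qed.

Lemma xy_slice u : form_map xyform (slice_vec u) = u.
Proof.
apply/matrixP => i j; rewrite ord1 mxE; move: i; apply: I2P.
  rewrite xy0 pval_xform !pl_wedge !minor3 !slice_mxE //=; ring.
rewrite xy1 pval_yform !pl_wedge !minor3 !slice_mxE //=; ring.
Qed.

Lemma xy_torus t v : torus K 7 t ->
  form_map xyform (compound 3 t *m v) = form_map xyform v.
Proof.
move=> Tt; have [d tE _] := torus_compound 3 Tt; have [_] := Tt.
rewrite tE det_diag big7; set d0 := d ord0 (inord 0); set d1 := d ord0 (inord 1).
set d2 := d ord0 (inord 2); set d3 := d ord0 (inord 3); set d4 := d ord0 (inord 4).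
set d5 := d ord0 (inord 5); set d6 := d ord0 (inord 6) => dE.
have pE a b c : pl (tri a b c) (compound 3 (diag_mx d) *m v) =
    d ord0 (inord a) * (d ord0 (inord b) * d ord0 (inord c)) * pl (tri a b c) v.
  by rewrite diag_compound big3 /tri !inordK.
apply/matrixP => i j; rewrite !mxE; move: i; apply: I2P.
  rewrite xy0 !pval_xform !pE -/d0 -/d1 -/d2 -/d3 -/d4 -/d5 -/d6.
  set A := pl _ v; set B := pl _ v; set C := pl _ v; set D := pl _ v; set E := pl _ v.
  transitivity ((d0 * (d1 * (d2 * (d3 * (d4 * (d5 * d6)))))) ^+ 3 * (A * B * C * D * E ^+ 3)).
    by ring.
  by rewrite dE expr1n mul1r.
rewrite xy1 !pval_yform !pE -/d0 -/d1 -/d2 -/d3 -/d4 -/d5 -/d6.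
set A := pl _ v; set B := pl _ v; set C := pl _ v; set D := pl _ v; set E := pl _ v.
set F := pl _ v.
transitivity ((d0 * (d1 * (d2 * (d3 * (d4 * (d5 * d6)))))) ^+ 3 * (A * B * C * D * E * F ^+ 2)).
  by ring.
by rewrite dE expr1n mul1r.
Qed.

Lemma xy_homog a v : form_map xyform (a *: v) = a ^+ 7 *: form_map xyform v.
Proof.
by apply/matrixP => i j; rewrite !mxE (pval_homog _ _ (xyform_homog i)).
Qed.

Definition slice_ev u s : K := s <[slice_vec u]>%VS (slice_vec u).

(** The torus element diag(z^2, ..., z^2, z^-5, z^-5) followed by a change of
    basis of determinant z rescales the slice coordinates by z^7. *)
Lemma slice_ev_homog m s a u : inv_sections T X (m * 7) s -> a != 0 ->
  slice_ev (a *: u) s = a ^+ m * slice_ev u s.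
Proof.
move=> sinv a0; have [z zE] := nth_root a (n := 7) isT.
have z0 : z != 0 by apply: contraNneq a0 => z0; rewrite -zE z0 expr0n.
pose d : 'rV[K]_7 := \row_j nth 0 [:: z ^+ 2; z ^+ 2; z ^+ 2; z ^+ 2; z ^+ 2; z ^- 5; z ^- 5] j.
pose rho : 'rV[K]_3 := \row_j nth 0 [:: z ^- 2; z ^- 2; z ^+ 5] j.
have Td : torus K 7 (diag_mx d).
  split; first exact: diag_mx_is_diag.
  by rewrite det_diag big7 !mxE !inordK //=; field.
have E : slice_vec (a *: u) = z *: (compound 3 (diag_mx d) *m slice_vec u).
  rewrite compound_diag_wedge.
  have -> : z = \det (diag_mx rho) by rewrite det_diag big3 !mxE !inordK //=; field.
  rewrite -wedge_mulmx /slice_vec /slice_pt; congr (wedge _).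
  apply/matrixP; apply: I7P; apply: I3P; rewrite mul_mx_diag mul_diag_mx !mxE !inordK //=;
    rewrite ?mulr0 ?mul0r // -?zE; field => //.
have lE : <[slice_vec (a *: u)]>%VS = lmove (compound 3 (diag_mx d)) <[slice_vec u]>%VS.
  rewrite lmove_line; apply/esym/lineE; last exact: slice_vec0.
    apply: line_point; apply: contraNneq (slice_vec0 (a *: u)) => E0.
    by rewrite E E0 scaler0.
  by rewrite E rpredZ // memv_line.
rewrite /slice_ev lE E (inv_homog _ _ sinv z0) mulnC exprM zE.
by rewrite (inv_move _ sinv (slice_rich _ _) Td).
Qed.

(** The point (0, 0) of the slice is not semistable but still lies on X, so the
    parameters need not avoid it. *)
Lemma slice_ev_curve m s (p q : {poly K}) : inv_sections T X (m * 7) s ->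
  exists h : {poly K}, forall z, slice_ev (\col_i nth 0 [:: p.[z]; q.[z]] i) s = h.[z].
Proof.
move=> sinv; apply: regular_line_poly => z0.
pose c (a : 'I_(ext_dim 3 7)) : {poly K} := \det (rowsub (enum_val a) (slice_mx p q)).
have cE z : curve_point c z = slice_vec (\col_i nth 0 [:: p.[z]; q.[z]] i).
  by rewrite wedge_curve map_slice_mx /slice_vec !mxE.
have [sX _ _] := sinv.
have [||f [g [r [g0 r0 E]]]] := section_curve (c := c) (z0 := z0) (@rich_proj K) sX.
- by rewrite cE slice_vec0.
- by rewrite cE; exact: slice_rich.
exists f, g, r; split=> // z rz; rewrite /slice_ev -cE; apply: E => //.
  by rewrite cE slice_vec0.
by rewrite cE; exact: slice_rich.
Qed.

(** On the charts (z, 1) and (1, z) the section is a polynomial h, respectively k;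
    by homogeneity h(z) = z^m k(1/z), which bounds the degree of h by m. *)
Lemma inv_binary_form m s : inv_sections T X (m * 7) s ->
  exists2 F : {mpoly K[2]}, F \is m.-homog & forall u, u != 0 -> slice_ev u s = pval F u.
Proof.
move=> sinv; pose vec (a b : K) : 'cV[K]_2 := \col_i nth 0 [:: a; b] i.
have vecE u : u = vec (u i0 ord0) (u i1 ord0).
  by apply/matrixP => i j; rewrite ord1 !mxE; move: i; apply: I2P.
have vecZ c a b : c *: vec a b = vec (c * a) (c * b).
  by apply/matrixP => i j; rewrite ord1 !mxE; move: i; apply: I2P.
have [h hE] := slice_ev_curve 'X 1 sinv; have [k kE] := slice_ev_curve 1 'X sinv.
have {}hE z : slice_ev (vec z 1) s = h.[z] by rewrite -hE hornerX hornerC.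
have {}kE z : slice_ev (vec 1 z) s = k.[z] by rewrite -kE hornerX hornerC.
(* rk is k with its coefficients reversed, as a polynomial of degree n. *)
pose n := size k; pose rk : {poly K} := \sum_(j < n.+1) k`_j *: 'X^(n - j).
have hk : 'X^n * h = 'X^m * rk.
  apply: (@poly_eq_off_roots _ _ _ 'X); first by rewrite polyX_eq0.
  move=> z; rewrite hornerX => z0; rewrite !hornerM !hornerXn -hE.
  have -> : vec z 1 = z *: vec 1 z^-1 by rewrite vecZ mulr1 divff.
  rewrite (slice_ev_homog _ sinv z0) kE mulrCA; congr (_ * _).
  rewrite (horner_coef_wide (n := n.+1)) ?leqnSn // mulr_sumr horner_sum.
  apply: eq_bigr => j _; rewrite hornerZ hornerXn mulrCA exprVn.
  by rewrite expfB_cond ?(negPf z0) ?add0n // ltnSE.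
have [F Fm FE] := bform_homog m h; exists F => // u u0; rewrite FE.
have srk : (size rk <= n.+1)%N.
  apply: (leq_trans (size_sum _ _ _)); apply/bigmax_leqP => j _.
  by rewrite (leq_trans (size_scale_leq _ _)) // size_polyXn ltnS leq_subr.
have hm i : (m < i)%N -> h`_i = 0.
  move=> mi; have := congr1 (fun p : {poly K} => p`_(n + i)) hk.
  rewrite !coefXnM ltnNge leq_addr /= addKn => ->.
  case: ifP => // _; rewrite nth_default // (leq_trans srk) //.
  by rewrite ltn_subRL addnC ltn_add2l.
have h0 : h`_m = k`_0.
  have := congr1 (fun p : {poly K} => p`_(n + m)) hk.
  rewrite !coefXnM !ltnNge leq_addr leq_addl /= addKn addnK => ->.
  rewrite coef_sum big_ord_recl /= subn0 coefZ coefXn eqxx mulr1 big1 ?addr0 // => j _.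
  rewrite coefZ coefXn /bump /= add1n (_ : (n == _) = false) ?mulr0 //.
  by apply/negbTE; rewrite neq_ltn orbC ltn_subrL /= (leq_ltn_trans _ (ltn_ord j)).
rewrite [u in LHS]vecE; have [t0|t0] := eqVneq (u i1 ord0) 0.
  have s0 : u i0 ord0 != 0.
    by apply: contraNneq u0 => s0; apply/eqP; rewrite [u]vecE s0 t0; apply/matrixP => i j;
       rewrite ord1 !mxE; move: i; apply: I2P.
  have -> : vec (u i0 ord0) (u i1 ord0) = u i0 ord0 *: vec 1 0 by rewrite vecZ t0 mulr1 mulr0.
  rewrite (slice_ev_homog _ sinv s0) kE horner_coef0 -h0.
  rewrite /bform big_ord_recr /= subnn mulr1 big1 ?add0r 1?mulrC // => i _.
  by rewrite t0 expr0n subn_eq0 leqNgt ltn_ord mulr0.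
have -> : vec (u i0 ord0) (u i1 ord0) = u i1 ord0 *: vec (u i0 ord0 / u i1 ord0) 1.
  by rewrite vecZ mulr1 mulrC divfK.
rewrite (slice_ev_homog _ sinv t0) hE.
rewrite (horner_coef_wide (n := m.+1)); last by apply/leq_sizeP => i; exact: hm.
rewrite mulr_sumr; apply: eq_bigr => i _; rewrite mulrCA -mulrA; congr (_ * _).
rewrite expr_div_n mulrCA; congr (_ * _).
by rewrite expfB_cond ?(negPf t0) ?add0n // ltnSE.
Qed.

End InvariantSections.

(** * The ring of invariants *)

Section SectionRing.
Variables (K : closedFieldType) (n : nat) (X : set {vspace 'cV[K]_n}).
Hypothesis Xp : X `<=` proj_space n.
Implicit Types (U : set {vspace 'cV[K]_n}) (s : {vspace 'cV[K]_n} -> 'cV[K]_n -> K).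

Lemma sec_eq d U s s' : (forall l, U l -> s l = s' l) ->
  sec (twist X d) U s -> sec (twist X d) U s'.
Proof.
move=> E sU l Ul; have [s0 sh [V [e [f [g [oV [Vl VU] fg F]]]]]] := sU l Ul.
rewrite -E //; split=> //; exists V, e, f, g; split=> // l' v Vl'.
by rewrite -E; [exact: F|exact: VU].
Qed.

Lemma sec_sub d U s s' : sec (twist X d) U s -> sec (twist X d) U s' ->
  sec (twist X d) U (fun l v => s l v - s' l v).
Proof.
move=> sU sU' l Ul; have [s0 sh [V [e [f [g [oV [Vl VU] /andP[fd gd] F]]]]]] := sU l Ul.
have [s0' sh' [V' [e' [f' [g' [oV' [Vl' VU'] /andP[fd' gd'] F']]]]]] := sU' l Ul.
split=> [v v0|a v a0|]; first by rewrite s0 // s0' // subrr.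
  by rewrite sh // sh' // mulrBr.
exists (V `&` V'), (e + e')%N, (f * g' - g * f'), (g * g'); split.
- exact: qopenI.
- by split=> // y [/VU].
- rewrite dhomogM // andbT rpredB //.
    by rewrite addnA dhomogM.
  by rewrite addnCA dhomogM.
- move=> l' v [V1 V2] vl v0; have [gv ->] := F l' v V1 vl v0; have [gv' ->] := F' l' v V2 vl v0.
  rewrite pvalM mulf_neq0 //; split=> //.
  by rewrite /pval mevalB !mevalM -!/(pval _ _) -mulNr addf_div // mulNr [pval f' v * _]mulrC.
Qed.

Lemma sec_mul d d' U s s' : sec (twist X d) U s -> sec (twist X d') U s' ->
  sec (twist X (d + d')) U (fun l v => s l v * s' l v).
Proof.
move=> sU sU' l Ul; have [s0 sh [V [e [f [g [oV [Vl VU] /andP[fd gd] F]]]]]] := sU l Ul.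
have [s0' sh' [V' [e' [f' [g' [oV' [Vl' VU'] /andP[fd' gd'] F']]]]]] := sU' l Ul.
split=> [v v0|a v a0|]; first by rewrite s0 // mul0r.
  by rewrite sh // sh' // exprD mulrACA.
exists (V `&` V'), (e + e')%N, (f * f'), (g * g'); split.
- exact: qopenI.
- by split=> // y [/VU].
- by rewrite addnACA !dhomogM.
- move=> l' v [V1 V2] vl v0; have [gv ->] := F l' v V1 vl v0; have [gv' ->] := F' l' v V2 vl v0.
  by rewrite !pvalM mulf_neq0 // mulf_div.
Qed.

Lemma sec_scale d U c s : sec (twist X d) U s -> sec (twist X d) U (fun l v => c * s l v).
Proof.
move=> sU l Ul; have [s0 sh [V [e [f [g [oV [Vl VU] /andP[fd gd] F]]]]]] := sU l Ul.
split=> [v v0|a v a0|]; first by rewrite s0 // mulr0.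
  by rewrite sh // mulrCA.
exists V, e, (c *: f), g; split=> //; first by rewrite dhomogZ.
move=> l' v V1 vl v0; have [gv ->] := F l' v V1 vl v0; split=> //.
by rewrite [pval (c *: f) v]mevalZ mulrA.
Qed.

Variable H : set 'M[K]_n.

Lemma fun_subE s s' l v : (s - s') l v = s l v - s' l v. Proof. by []. Qed.
Lemma fun_mulE s s' l v : (s * s') l v = s l v * s' l v. Proof. by []. Qed.

Lemma inv_sub m s s' : inv_sections H X m s -> inv_sections H X m s' ->
  inv_sections H X m (s - s').
Proof.
move=> [sX s0 sH] [sX' s0' sH']; split; first exact: sec_sub.
  by move=> l nl; apply/funext => v; rewrite fun_subE s0 // s0' // subrr.
move=> t l Ht Xl; apply/funext => v.
by rewrite fun_subE sH // sH'.
Qed.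

Lemma inv_mul m m' s s' : inv_sections H X m s -> inv_sections H X m' s' ->
  inv_sections H X (m + m') (s * s').
Proof.
move=> [sX s0 sH] [sX' s0' sH']; split; first exact: sec_mul.
  by move=> l nl; apply/funext => v; rewrite fun_mulE s0 // mul0r.
move=> t l Ht Xl; apply/funext => v.
by rewrite fun_mulE sH // sH'.
Qed.

Lemma inv_scale m c s : inv_sections H X m s ->
  inv_sections H X m ((fun _ _ => c) * s).
Proof.
move=> [sX s0 sH]; split; first exact: sec_scale.
  by move=> l nl; apply/funext => v; rewrite fun_mulE s0 // mulr0.
move=> t l Ht Xl; apply/funext => v.
by rewrite fun_mulE sH.
Qed.

End SectionRing.

Lemma mem_lmove (K : closedFieldType) n (g : 'M[K]_n) l v : g \in unitmx ->
  (g *m v \in lmove g l) = (v \in l).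
Proof.
move=> gu; have E w : linfun (mulmx g) w = g *m w :> 'cV_n by rewrite lfunE.
apply/idP/idP => [/memv_imgP[w wl]|vl]; last by rewrite -E memv_img.
by rewrite E => /(congr1 (mulmx (invmx g))); rewrite !mulKmx // => ->.
Qed.

Section SliceAlgebra.
Variable K : closedFieldType.
Local Notation line := {vspace 'cV[K]_(ext_dim 3 7)}.
Local Notation X := (@rich K).
Local Notation T := (@ext_torus K).
Implicit Types (l : line) (s : line -> 'cV[K]_(ext_dim 3 7) -> K) (F : {mpoly K[2]}).

Lemma slice_vec_rich (u : 'cV[K]_2) : X <[slice_vec u]>%VS. Proof. exact: slice_rich. Qed.

Definition orbit_slice l := exists t u,
  [/\ torus K 7 t, u != 0 & l = lmove (compound 3 t) <[slice_vec u]>%VS].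

Definition binary_section F l v : K :=
  if pselect (X l) then form_section (F \mPo @xyform K) l v else 0.

Lemma binary_section_inv m F : F \is m.-homog -> inv_sections T X (m * 7) (binary_section F).
Proof.
move=> Fm; have Gm := homog_comp Fm (@xyform_homog K); rewrite mulnC; split.
- apply: sec_eq (form_section_sec Gm (qopenT (@rich_proj K))) => l Xl.
  by apply/funext => v; rewrite /binary_section; case: pselect.
- by move=> l nX; apply/funext => v; rewrite /binary_section; case: pselect.
move=> t l [t' Tt' <-] Xl; have [d tE cu] := torus_compound 3 Tt'.
apply/funext => v; rewrite /smove /binary_section; case: pselect => [?|]; last first.
  by case; exact: rich_torus.
case: pselect => // ?; rewrite -[v in LHS](mulKVmx cu); set w := invmx _ *m v.
rewrite /form_section mem_lmove // !pval_comp -/(form_map _ _) -/(form_map _ w) xy_torus //.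
suff -> : (compound 3 t' *m w == 0) = (w == 0) by [].
by apply/eqP/eqP => [E|->]; rewrite ?mulmx0 // -(mulKmx cu w) E mulmx0.
Qed.

Lemma slice_ev_binary F u : u != 0 -> slice_ev u (binary_section F) = pval F u.
Proof.
move=> u0; rewrite /slice_ev /binary_section; case: pselect => [?|]; last first.
  by case; exact: slice_rich.
by rewrite form_sectionE ?memv_line ?slice_vec0 // pval_comp -/(form_map _ _) xy_slice.
Qed.

Lemma inv_orbit_zero m s t u : inv_sections T X m s -> torus K 7 t ->
  s (lmove (compound 3 t) <[slice_vec u]>%VS) = (fun=> 0) <-> slice_ev u s = 0.
Proof.
move=> sinv Tt; have [d tE cu] := torus_compound 3 Tt.
have mv := inv_move _ sinv (slice_vec_rich u) Tt.
split=> [E|E]; first by rewrite /slice_ev -mv E.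
apply/funext => v; rewrite -(mulKVmx cu v) mv; set w := invmx _ *m v.
have [/(inv_off sinv) -> //|] := boolP ((w \notin <[slice_vec u]>%VS) || (w == 0)).
rewrite negb_or negbK => /andP[/vlineP[a ->]]; rewrite scaler_eq0 negb_or => /andP[a0 _].
by rewrite (inv_homog _ _ sinv a0) -/(slice_ev u s) E mulr0.
Qed.

(** That a section of degree 0 vanishing on the slice is zero would depend on the
    connectedness of X. In any case, it is annihilated by all sections of
    positive degree, and so it lies in every relevant prime. *)
Lemma slice_algebra : binary_form_algebra (fun (c : K) (_ : line) (_ : 'cV[K]_(ext_dim 3 7)) => c)
  (fun m => inv_sections T X (m * 7)) (@slice_ev K).
Proof.
split=> //.
- by move=> m f g; apply: inv_sub; exact: rich_proj.
- by move=> k m f g Rf Rg; rewrite mulnDl; apply: inv_mul => //; exact: rich_proj.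
- by move=> m c f; apply: inv_scale.
- move=> m F Fm; exists (binary_section F); first exact: binary_section_inv.
  by move=> u; exact: slice_ev_binary.
- move=> m f; exact: inv_binary_form.
move=> p m f [pR p0 _ pprime [k [g [k0 Rg ng]]]] Rf f0.
have fg : f * g = 0.
  apply/funext => l; apply/funext => v; rewrite fun_mulE.
  have [->|gv] := eqVneq (g l v) 0; first by rewrite mulr0.
  have [t [u [Tt u0 ->]]] := inv_nonzero_orbit Rg k0 gv.
  by have /(inv_orbit_zero _ Rf Tt) -> := f0 u u0; rewrite mul0r.
by case: (pprime _ _ _ _ Rf Rg) => //; rewrite fg; exact: (p0 _).1.
Qed.

Lemma semistableP l : semistable T X 7 l <-> orbit_slice l.
Proof.
split=> [[Xl [m [s [v [m0 sinv sv]]]]]|[t [u [Tt u0 ->]]]].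
  exact: inv_nonzero_orbit sinv m0 sv.
split; first by apply: rich_torus Tt; exact: slice_rich.
have [i ui] := line_coord u0.
pose s := binary_section 'X_i; have sinv : inv_sections T X (1 * 7) s := binary_section_inv (homogXU K i).
exists 1%N, s, (compound 3 t *m slice_vec u); split=> //.
rewrite (inv_move _ sinv (slice_vec_rich u) Tt) -/(slice_ev u s).
by rewrite slice_ev_binary // /pval mevalXU.
Qed.

Lemma semistable_proj : semistable T X 7 `<=` proj_space _.
Proof. by move=> l [/rich_proj]. Qed.

End SliceAlgebra.

(** * The quotient *)

Section Quotient.
Variable K : closedFieldType.
Local Notation line := {vspace 'cV[K]_(ext_dim 3 7)}.
Local Notation X := (@rich K).
Local Notation T := (@ext_torus K).
Local Notation ss := (semistable T X 7).
Local Notation Q := (git_quotient T X 7).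
Local Notation P1 := (@proj_space K 2).
Local Notation R := (fun m => inv_sections T X (m * 7)).
Local Notation ev := (@slice_ev K).
Local Notation B := (slice_algebra K).
Local Notation xy := (form_map (@xyform K)).
Local Notation phi := (@proj_to_line K _ R ev).
Local Notation gm := (@git_map K _ T X 7).
Implicit Types (l : line).

Lemma ss_xy l v : ss l -> v \in l -> v != 0 -> xy v != 0.
Proof.
move=> /semistableP[t [u [Tt u0 ->]]]; have [d tE cu] := torus_compound 3 Tt.
rewrite lmove_line => /vlineP[a ->]; rewrite scaler_eq0 negb_or => /andP[a0 _].
by rewrite xy_homog xy_torus // xy_slice scaler_eq0 negb_or expf_neq0.
Qed.

Definition ss_to_line l : {vspace 'cV[K]_2} := <[xy (vpick l)]>%VS.

Lemma ss_to_lineE l v : ss l -> v \in l -> v != 0 -> ss_to_line l = <[xy v]>%VS.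
Proof.
move=> sl vl v0; have l1 := semistable_proj sl.
have p0 : vpick l != 0 by rewrite vpick0 -dimv_eq0 (l1 : \dim l = 1%N).
have pl := memv_pick l.
apply: (lineE _ _ (ss_xy sl vl v0)); first exact/line_point/(ss_xy sl pl p0).
have /vlineP[a ->] : v \in <[vpick l]>%VS by rewrite -(lineE l1 pl p0).
by rewrite xy_homog rpredZ // memv_line.
Qed.

Lemma ss_to_line_proj l : ss l -> P1 (ss_to_line l).
Proof.
move=> sl; have [v v0 lE] := line_has (semistable_proj sl).
have vl : v \in l by rewrite lE memv_line.
by rewrite (ss_to_lineE sl vl v0); apply/line_point/(ss_xy sl vl v0).
Qed.

Lemma git_mapE l : ss l -> gm l = bf_point R ev (ss_to_line l).
Proof.
move=> sl; have [t [u [Tt u0 lE]]] := (semistableP l).1 sl.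
have [d tE cu] := torus_compound 3 Tt.
have vl : compound 3 t *m slice_vec u \in l by rewrite lE mem_lmove // memv_line.
have v0 : compound 3 t *m slice_vec u != 0.
  by apply: contraNneq (slice_vec0 u) => E; rewrite -(mulKmx cu (slice_vec u)) E mulmx0.
have pE : ss_to_line l = <[u]>%VS by rewrite (ss_to_lineE sl vl v0) xy_torus // xy_slice.
apply/funext => m; rewrite predeqE => s.
have P := bf_pointP B m s (line_point u0) (memv_line u) u0.
rewrite pE; split=> [[sinv]|/P[sinv E]].
  by rewrite lE => /(inv_orbit_zero _ sinv Tt) E; apply/P.
by split=> //; rewrite lE; apply/(inv_orbit_zero _ sinv Tt).
Qed.

Lemma phi_git_map l : ss l -> phi (gm l) = ss_to_line l.
Proof. by move=> sl; rewrite git_mapE // (proj_to_lineK B) //; exact: ss_to_line_proj. Qed.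

Lemma ss_sheaf : function_sheaf (qproj ss).
Proof. exact: qproj_function_sheaf (@semistable_proj K). Qed.

Lemma git_map_morphism : is_morphism (gm : qproj ss -> Q).
Proof.
apply: (morphism_comp (f := ss_to_line : qproj ss -> qproj P1) ss_sheaf _ (bf_point_morphism B) git_mapE).
apply: (forms_morphism (@semistable_proj K) (@subset_refl _ _) (@xyform_homog K)) => l v sl vl v0.
by split; [exact: ss_xy vl v0|exact: ss_to_lineE|exact: ss_to_line_proj].
Qed.

Lemma P1_sheaf : function_sheaf (qproj P1).
Proof. exact: (qproj_function_sheaf (@subset_refl _ P1)). Qed.

Lemma O1_sheaf : section_sheaf (twist P1 1).
Proof. exact: (twist_section_sheaf (@subset_refl _ P1) 1). Qed.

Lemma O1_frame i : frame (twist P1 1) (P1 `&` nonvanishing 'X_i) (form_section 'X_i).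
Proof. exact: (twist_frame (@subset_refl _ _) (homogXU K i)). Qed.

Lemma O1_line_bundle : is_line_bundle (twist P1 1).
Proof.
move=> l l1; have [u u0 lE] := line_has l1; have [i ui] := line_coord u0.
have [oU eU sU] := O1_frame i.
exists (P1 `&` nonvanishing 'X_i), (form_section 'X_i); split=> //.
by split=> //; exists u; rewrite ?lE ?memv_line // /pval mevalXU.
Qed.

Definition line_ratio (w u : 'cV[K]_2) : K :=
  if u i0 ord0 == 0 then w i1 ord0 / u i1 ord0 else w i0 ord0 / u i0 ord0.

Lemma line_ratioZ c (u : 'cV[K]_2) : u != 0 -> line_ratio (c *: u) u = c.
Proof.
move=> u0; rewrite /line_ratio !mxE; case: eqP => [u00|/eqP u00]; last by rewrite mulfK.
rewrite mulfK //; apply: contraNneq u0 => u01; apply/eqP/matrixP => i j.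
by rewrite ord1 mxE; move: i; apply: I2P.
Qed.

(** The point (x(v), y(v)) depends on v homogeneously of degree 7, so a function s
    on l of degree 7 descends to the function c (x(v), y(v)) |-> c s(v), which is
    homogeneous of degree 1. *)
Definition descend l (s : 'cV[K]_(ext_dim 3 7) -> K^o) : 'cV[K]_2 -> K^o := fun w =>
  if w \in ss_to_line l then line_ratio w (xy (vpick l)) * s (vpick l) else 0.

Lemma descendE l s v w : ss l -> fib (twist ss 7) l s -> v \in l -> v != 0 ->
  descend l s w = if w \in <[xy v]>%VS then line_ratio w (xy v) * s v else 0.
Proof.
move=> sl [s0 sh] vl v0; rewrite /descend (ss_to_lineE sl vl v0); case: ifP => // wv.
have l1 := semistable_proj sl.
have p0 : vpick l != 0 by rewrite vpick0 -dimv_eq0 (l1 : \dim l = 1%N).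
have /vlineP[a pE] : vpick l \in <[v]>%VS by rewrite -(lineE l1 vl v0) memv_pick.
have a0 : a != 0 by apply: contraNneq p0 => a0; rewrite pE a0 scale0r.
have xv := ss_xy sl vl v0; move: wv => /vlineP[c ->].
rewrite line_ratioZ // pE sh // xy_homog.
have -> : c *: xy v = (c / a ^+ 7) *: (a ^+ 7 *: xy v).
  by rewrite scalerA divfK // expf_neq0.
rewrite line_ratioZ; last by rewrite scaler_eq0 negb_or expf_neq0.
by rewrite mulrA divfK // expf_neq0.
Qed.

(** The sections x and y correspond to the coordinates of the plane. *)
Lemma descend_form l i : ss l ->
  descend l (form_section (tnth (@xyform K) i) l) = form_section 'X_i (ss_to_line l).
Proof.
move=> sl; have [v v0 lE] := line_has (semistable_proj sl).
have vl : v \in l by rewrite lE memv_line.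
have xv := ss_xy sl vl v0.
apply/funext => w; rewrite (descendE _ sl _ vl v0); last first.
  exact: (form_section_fib _ _ (@xyform_homog K i)).
rewrite /form_section (ss_to_lineE sl vl v0) vl v0 /=; case: vlineP => //= -[c ->].
rewrite line_ratioZ // scaler_eq0 negb_or xv andbT /pval mevalXU !mxE.
by case: eqP => [->|] //=; rewrite mul0r.
Qed.

Local Notation O1Q := (pullback (phi : Q -> qproj P1) (twist P1 1)).

Lemma Q_sheaf : function_sheaf Q. Proof. exact: (Proj_function_sheaf B). Qed.

Lemma descend_iso : @is_bundle_iso K (qproj ss) (twist ss 7) (pullback gm O1Q) descend.
Proof.
have phim := proj_to_line_morphism B.
have O1Qs : section_sheaf O1Q.
  by apply: pullback_section_sheaf; exact: Q_sheaf.
apply: (bundle_iso_frames ss_sheaf).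
- exact: (twist_section_sheaf (@semistable_proj K) 7).
- by apply: pullback_section_sheaf; exact: ss_sheaf.
- have linE m b (f g : 'cV[K]_m -> K^o) w : (b *: f + g) w = b * f w + g w by [].
  move=> l a s s'; apply/funext => w; rewrite linE /descend linE.
  by case: ifP => _; [ring|rewrite mulr0 addr0].
move=> l sl; have [v v0 lE] := line_has (semistable_proj sl).
have vl : v \in l by rewrite lE memv_line.
have [i xi] := line_coord (ss_xy sl vl v0); rewrite mxE in xi.
have Fi := @xyform_homog K i.
pose U := ss `&` nonvanishing (tnth (@xyform K) i).
exists U, (form_section (tnth (@xyform K) i)), (fun l => form_section 'X_i (phi (gm l))).
split.
- by split=> //; exists v.
- exact: (twist_frame (@semistable_proj K) Fi).
- have UE : U = pts (qproj ss) `&` gm @^-1` (pts Q `&` phi @^-1` (P1 `&` nonvanishing 'X_i)).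
    rewrite predeqE => l'; split=> -[sl'].
      move=> xl'; split=> //; have [gp _ _] := git_map_morphism.
      split; first exact: gp; rewrite /= phi_git_map //; split; first exact: ss_to_line_proj.
      have [v' v'0 lE'] := line_has (semistable_proj sl').
      have vl' : v' \in l' by rewrite lE' memv_line.
      rewrite (ss_to_lineE sl' vl' v'0).
      apply/(nonvanishing_line (homogXU K i) (ss_xy sl' vl' v'0)).
      rewrite /pval mevalXU mxE; apply/(nonvanishing_line Fi v'0); by rewrite -lE'.
    move=> [_ [_ /=]]; rewrite phi_git_map // => xl'; split=> //.
    have [v' v'0 lE'] := line_has (semistable_proj sl').
    have vl' : v' \in l' by rewrite lE' memv_line.
    move: xl'; rewrite (ss_to_lineE sl' vl' v'0).
    move=> /(nonvanishing_line (homogXU K i) (ss_xy sl' vl' v'0)).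
    by rewrite /pval mevalXU mxE => xv; exists v'.
  have F1 := pullback_frame Q_sheaf P1_sheaf O1_sheaf phim (O1_frame i).
  by rewrite UE; exact: (pullback_frame ss_sheaf Q_sheaf O1Qs git_map_morphism F1).
- by move=> l' [sl' _]; rewrite descend_form // phi_git_map.
Qed.

Lemma descend_torus t l s : T t -> ss l -> fib (twist ss 7) l s ->
  descend (lmove t l) (smove t s) = descend l s.
Proof.
move=> [t' Tt <-] sl sf; have [d tE cu] := torus_compound 3 Tt.
have stl : ss (lmove (compound 3 t') l).
  have [Xl [m [f [v [m0 finv fv]]]]] := sl; split; first exact: rich_torus.
  by exists m, f, (compound 3 t' *m v); split=> //; rewrite (inv_move _ finv Xl Tt).
have [v v0 lE] := line_has (semistable_proj sl).
have vl : v \in l by rewrite lE memv_line.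
have tv0 : compound 3 t' *m v != 0.
  by apply: contraNneq v0 => E; rewrite -(mulKmx cu v) E mulmx0.
apply/funext => w; rewrite (descendE _ sl sf vl v0) (descendE (v := compound 3 t' *m v)) //.
- by rewrite xy_torus // /smove mulKmx.
- have [s0 sh] := sf; split=> [z z0|a z a0]; rewrite /smove.
    apply: s0; move: z0; rewrite -{1 2}(mulKVmx cu z) mem_lmove //.
    case: (_ \in l) => //= /eqP E; rewrite -(mulKmx cu (invmx _ *m z)) E mulmx0 eqxx; done.
  by rewrite -scalemxAr sh.
- by rewrite mem_lmove.
Qed.

Theorem richardson_quotient :
  exists phi : Q -> qproj P1, is_isomorphism phi /\ is_descent (pullback phi (twist P1 1)).
Proof.
exists phi; split; first exact: (proj_to_line_iso B).
split.
  exact: (pullback_line_bundle Q_sheaf P1_sheaf O1_sheaf (proj_to_line_morphism B) O1_line_bundle).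
by exists descend; split; [exact: descend_iso|exact: descend_torus].
Qed.

End Quotient.

Lemma first3_s3s2 : first3 (s_ 3 * s_ 2)%g = tri 0 2 3.
Proof.
apply/funext => i; rewrite /first3 /tri.
have -> : widen_ord (isT : 3 <= 7)%N i = inord i by apply/val_inj; rewrite /= inordK // (leq_trans (ltn_ord i)).
have E a b : (a < 7)%N -> (b < 7)%N -> ((inord a : 'I_7) == inord b) = (a == b).
  by move=> a7 b7; rewrite -val_eqE /= !inordK.
by move: i; apply: I3P; rewrite permM /s_ !permE /= !inordK //= !E //= !permE /= ?E //= ?E.
Qed.

(* Products of permutations are read from left to right in 'S_7, so the
   composite s_2 s_3, with s_2 s_3 (3) = s_2 (4) = 4, is s_ 3 * s_ 2. *)
Theorem lemma5p10 (R : realType) :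
  let K : closedFieldType := R[i]%C in
  let v : 'S_7 := (s_ 3 * s_ 2)%g in
  let X := richardson K (first3 v) w37 in
  let T : set 'M[K]_(ext_dim 3 7) := [set compound 3 t | t in torus K 7]%classic in
  let P1 : variety K := qproj (proj_space 2) in
  exists phi : git_quotient T X 7 -> P1,
    is_isomorphism phi /\
    is_descent (pullback phi (twist (proj_space 2) 1)).
Proof. by move=> K v X T P1; rewrite /X /v first3_s3s2; exact: richardson_quotient. Qed.
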